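(* Let $d\ge 2$, let $a_0,a_1,b_1,a_2\in\mathbb{R}_{\ge 0}$ be constants with $a_0>0$ and $a_2>0$, and let $G^1$ be the elastic metric with constant coefficients on open curves, $$G^1_c(h,k)=\int_{[0,2\pi]} a_0\langle h,k\rangle+a_1\langle D_sh^\top,D_sk^\top\rangle+b_1\langle D_sh^\bot,D_sk^\bot\rangle+a_2\langle D_s^2h,D_s^2k\rangle\,\mathrm{d}s .$$ Then the space $\left(\mathcal{I}^2([0,2\pi],\mathbb{R}^d),\mathrm{dist}^{G^1}\right)$ is metrically incomplete.
   Context: $\mathcal{I}^2([0,2\pi],\mathbb{R}^d)=\{c\in H^2([0,2\pi],\mathbb{R}^d): c'(\theta)\neq0\ \forall\theta\in[0,2\pi]\}$ is the space of open immersed curves of Sobolev class $H^2$, an open subset of the Hilbert space $H^2([0,2\pi],\mathbb{R}^d)$; tangent vectors $h,k$ at $c$ are elements of $H^2([0,2\pi],\mathbb{R}^d)$. $\langle\cdot,\cdot\rangle$ is the Euclidean inner product on $\mathbb{R}^d$. For a given curve $c$: $D_s=\frac{1}{|c'|}\partial_\theta$, $\mathrm{d}s=|c'|\,\mathrm{d}\theta$, $v=c'/|c'|$, $D_sh^\top:=\langle D_sh,v\rangle v$ and $D_sh^\bot:=D_sh-\langle D_sh,v\rangle v$. The geodesic distance $\mathrm{dist}^{G^1}(c_0,c_1)$ is the infimum of the lengths $L(c)=\int_0^1\sqrt{G^1_{c(t)}(\partial_tc(t),\partial_tc(t))}\,\mathrm{d}t$ over all smooth paths $c$ of immersions with $c(0)=c_0$,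 $c(1)=c_1$. *)

(* Defs.v *)
From mathcomp Require Import all_boot all_order all_algebra.
From mathcomp Require Import all_classical all_reals all_analysis.

Set Implicit Arguments.
Unset Strict Implicit.
Unset Printing Implicit Defensive.

Import Order.TTheory GRing.Theory Num.Theory.
Import numFieldNormedType.Exports.

Local Open Scope classical_set_scope.
Local Open Scope ring_scope.

(* The norm that MathComp-Analysis puts on row vectors is the sup norm, hence
   the separate Euclidean structure. *)
Definition dotp {R : realType} {d : nat} (u v : 'rV[R]_d) : R :=
  \sum_(j < d) u ord0 j * v ord0 j.

Definition enorm {R : realType} {d : nat} (u : 'rV[R]_d) : R :=
  Num.sqrt (dotp u u).

(* Derivatives relative to a set A: at an endpoint of an interval A this is the
   one-sided derivative, and only the values of f on A matter.  Where the limit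
   does not exist, deriv_on is a default value. *)
Definition diff_quot {R : realType} (f : R -> R) (x y : R) : R :=
  (f y - f x) / (y - x).

Definition derivable_on {R : realType} (A : set R) (f : R -> R) (x : R) : Prop :=
  cvg (diff_quot f x @ within A x^').

Definition deriv_on {R : realType} (A : set R) (f : R -> R) (x : R) : R :=
  lim (diff_quot f x @ within A x^').

Definition vderiv_on {R : realType} {d : nat} (A : set R)
    (f : R -> 'rV[R]_d) (x : R) : 'rV[R]_d :=
  \row_(j < d) deriv_on A (fun y => f y ord0 j) x.

Definition param {R : realType} : set R := `[0, 2 * pi].

Definition time {R : realType} : set R := `[0, 1].

Definition Dtheta {R : realType} {d : nat} (f : R -> 'rV[R]_d) : R -> 'rV[R]_d :=
  vderiv_on param f.

(* Compactly supported C^1 functions on the open interval ]0, 2 pi[. *)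
Definition test_function {R : realType} (phi : R -> R) : Prop :=
  [/\ forall x, derivable phi x 1,
      continuous (derive1 phi)
    & exists a b : R, [/\ 0 < a, b < 2 * pi &
        forall x, x \notin `[a, b] -> phi x = 0]].

Definition weak_derivative {R : realType} (f g : R -> R) : Prop :=
  forall phi : R -> R, test_function phi ->
    (\int[@lebesgue_measure R]_(x in param) (f x * derive1 phi x))%R =
    - (\int[@lebesgue_measure R]_(x in param) (g x * phi x))%R.

Definition L2 {R : realType} (g : R -> R) : Prop :=
  measurable_fun param g /\
  (\int[@lebesgue_measure R]_(x in param) ((g x ^+ 2)%:E) < +oo)%E.

(* Continuous representatives of the classes in H^1([0, 2 pi]); continuity on
   the compact interval makes f itself square integrable. *)
Definition H1 {R : realType} (f : R -> R) : Prop :=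
  {within param, continuous f} /\
  exists2 g : R -> R, L2 g & weak_derivative f g.

(* f is in H^2 iff f' is in H^1; the continuous representative of an H^2
   function is C^1 up to the endpoints, so its first weak derivative is the
   classical one.  The a.e. classical derivative of an H^1 function is its weak
   derivative, so iterating deriv_on gives the second weak derivative a.e. *)
Definition H2 {R : realType} (f : R -> R) : Prop :=
  (forall x, param x -> derivable_on param f x) /\ H1 (deriv_on param f).

(* Elements of H^2([0, 2 pi], R^d) are functions on R of which only the
   restriction to [0, 2 pi] is relevant. *)
Definition H2curve {R : realType} {d : nat} (c : R -> 'rV[R]_d) : Prop :=
  forall j : 'I_d, H2 (fun x => c x ord0 j).

Definition H2sqnorm {R : realType} {d : nat} (f : R -> 'rV[R]_d) : \bar R :=
  (\int[@lebesgue_measure R]_(x in param)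
    ((enorm (f x) ^+ 2 + enorm (Dtheta f x) ^+ 2
      + enorm (Dtheta (Dtheta f) x) ^+ 2)%:E))%E.

Definition immersions (R : realType) (d : nat) : set (R -> 'rV[R]_d) :=
  [set c | H2curve c /\ forall x, param x -> Dtheta c x != 0].

Section Metric.
Variables (R : realType) (d : nat).
Implicit Types c h k f : R -> 'rV[R]_d.

Definition Ds c f (x : R) : 'rV[R]_d :=
  (enorm (Dtheta c x))^-1 *: Dtheta f x.

Definition unit_tangent c (x : R) : 'rV[R]_d :=
  (enorm (Dtheta c x))^-1 *: Dtheta c x.

Definition Ds_tan c h (x : R) : 'rV[R]_d :=
  dotp (Ds c h x) (unit_tangent c x) *: unit_tangent c x.

Definition Ds_nor c h (x : R) : 'rV[R]_d :=
  Ds c h x - dotp (Ds c h x) (unit_tangent c x) *: unit_tangent c x.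

Definition G1 (a0 a1 b1 a2 : R) c h k : R :=
  (\int[@lebesgue_measure R]_(x in param)
    ((a0 * dotp (h x) (k x)
      + a1 * dotp (Ds_tan c h x) (Ds_tan c k x)
      + b1 * dotp (Ds_nor c h x) (Ds_nor c k x)
      + a2 * dotp (Ds c (Ds c h) x) (Ds c (Ds c k) x))
     * enorm (Dtheta c x)))%R.

Implicit Types p : R -> R -> 'rV[R]_d.

(* A path t |-> p t is differentiated pointwise in theta; smooth_path below
   demands that this is the derivative for the H^2 norm. *)
Definition Dt p (t x : R) : 'rV[R]_d :=
  vderiv_on time (fun s => p s x) t.

(* p is C^oo on [0, 1] as a map into the Hilbert space H^2([0, 2 pi], R^d). *)
Definition smooth_path p : Prop :=
  forall (n : nat) (t : R), time t ->
    H2curve (iter n Dt p t) /\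
    H2sqnorm (fun x => (s - t)^-1 *: (iter n Dt p s x - iter n Dt p t x)
                       - iter n.+1 Dt p t x) @[s --> within time t^'] --> 0%E.

Definition immersion_path c0 c1 p : Prop :=
  [/\ smooth_path p,
      forall t, time t -> @immersions R d (p t),
      forall x, param x -> p 0 x = c0 x
    & forall x, param x -> p 1 x = c1 x].

Definition path_length (a0 a1 b1 a2 : R) p : \bar R :=
  (\int[@lebesgue_measure R]_(t in time)
    ((Num.sqrt (G1 a0 a1 b1 a2 (p t) (Dt p t) (Dt p t)))%:E))%E.

Definition geodesic_dist (a0 a1 b1 a2 : R) c0 c1 : \bar R :=
  ereal_inf [set path_length a0 a1 b1 a2 p | p in immersion_path c0 c1].

End Metric.

Definition metrically_complete {R : realType} {T : Type} (X : set T)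
    (dist : T -> T -> \bar R) : Prop :=
  forall u : nat -> T,
    (forall n, X (u n)) ->
    (forall e : R, 0 < e -> exists N : nat, forall m n : nat,
       (N <= m)%N -> (N <= n)%N -> (dist (u m) (u n) < e%:E)%E) ->
    exists2 x : T, X x & dist (u n) x @[n --> \oo] --> 0%E.

(* Main.v *)
Require Import Defs.
From mathcomp Require Import all_boot all_order all_algebra.
From mathcomp Require Import all_classical all_reals all_analysis.
From mathcomp Require Import measurable_realfun ring lra.
Import Order.TTheory GRing.Theory Num.Theory.
Import numFieldNormedType.Exports.
Set Implicit Arguments.
Unset Strict Implicit.
Unset Printing Implicit Defensive.
Local Open Scope classical_set_scope.
Local Open Scope ring_scope.

(** A segment can be shrunk to a point at finite cost, and no immersed curve is
close to all short segments.

Shrinking.  Along t |-> rho(t)^2 theta (1, ..., 1) the velocity h has D_s h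
constant of size 2 |rho'| / rho and D_s^2 h = 0, while the arclength measure is
of size rho^2; hence G^1(h, h) is at most a constant times rho'^2 as long as
rho <= 1 (G1_ray).  The segments with rho = 1 / (n + 1) therefore form a Cauchy
sequence (dist_ray).

Obstruction.  Let c be a limit.  Being immersed, c separates two interior
points x < y (immersion_separates), whereas the chords u_n(y) - u_n(x) tend to
0.  On a path from u_n to c, some coordinate of the chord p_t(y) - p_t(x) thus
rises from almost 0 to a fixed value delta > 0.  After the last time at which
it equals delta / 2, the curve p_t has arclength at least delta / 2 between x
and y.  On arcs of length at least l, the a0 and a2 terms alone give
|h(y) - h(x)| <= C(l) sqrt (G^1(h, h)) (increment_bound), by interpolating the
end values of h between the L^2 norms of h and of D_s^2 h.  Integrating in time
bounds the length of the path from below by a constant depending only on delta,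
a0 and a2 (path_length_ge), so c is not a limit.  Since C(l) blows up when l tends to 0,
only the end of the path, where the chord is long, can be used.

Three points need care.  First, G^1 is written with pointwise derivatives, and
a bound on the oscillation of D_s h by the integral of its derivative requires
absolute continuity: abs_cont f g says that f is the primitive of g in L^2.
Functions in H^1 have this property by the du Bois-Reymond argument
(H1_abs_cont), and it passes to D_s h = h' / |c'| because a function whose
increments are dominated by those of a primitive, and which is differentiable
almost everywhere, is the primitive of its derivative (abs_cont_intro).
Secondly, the integrands in G^1 and in the length are not known to be
measurable; for nonnegative functions the integral is nevertheless monotone
(ge0_ae_le_integral_subset), which is all that is used.  Thirdly, smoothness of
a path in H^2 enters only through the values at interior points, which depend
smoothly on time by a Sobolev inequality (smooth_path_diff_quot). *)

(** * Monotonicity of the integral without measurability *)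

Section NonmeasurableIntegral.
Import HBNNSimple.
Context d (T : measurableType d) (R : realType)
        (mu : {measure set T -> \bar R}).
Local Open Scope ereal_scope.

(** The integral of a nonnegative function is the supremum over the simple
functions below it, so monotonicity does not involve measurability; a null set
where the inequality fails is removed by truncating the simple functions. *)
Lemma ge0_ae_le_integral_subset (D1 D2 : set T) (f1 f2 : T -> \bar R) :
  (forall x, D1 x -> 0 <= f1 x) -> (forall x, D2 x -> 0 <= f2 x) ->
  D1 `<=` D2 -> {ae mu, forall x, D1 x -> f1 x <= f2 x} ->
  \int[mu]_(x in D1) f1 x <= \int[mu]_(x in D2) f2 x.
Proof.
move=> f10 f20 D12 [N [mN N0 subN]].
rewrite ge0_integralE// [leRHS]ge0_integralE//.
apply: ge_ereal_sup => _ [h /= hf1 <-].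
have mCN : measurable (~` N) by exact: measurableC.
pose h' : {nnsfun T >-> R} := mul_nnsfun h (indic_nnsfun R mCN).
have -> : sintegral mu h = sintegral mu h'.
  rewrite -[LHS](_ : \int[mu]_(x in setT) (h x)%:E = _); last first.
    by rewrite integral_nnsfun// patch_setT.
  rewrite -[RHS](_ : \int[mu]_(x in setT) (h' x)%:E = _); last first.
    by rewrite integral_nnsfun// patch_setT.
  apply: ae_eq_integral => //; [exact/measurable_EFinP..|].
  exists N; split => // x /= hx; apply: contrapT => Nx; apply: hx => _.
  by rewrite /h' /= mindicE mem_set// mulr1.
apply: ereal_sup_ubound; exists h' => // x.
rewrite /h' /= mindicE; case: (pselect (N x)) => [Nx|Nx].
  rewrite memNset ?mulr0; last by move=> /(_ Nx).
  by apply: erestrict_ge0.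
rewrite mem_set// mulr1 (le_trans (hf1 x))// /patch.
case: ifPn => [|xD1].
  rewrite inE => xD1; rewrite mem_set; last exact: D12.
  by apply: contrapT => H; apply: Nx; apply: subN => /= /(_ xD1).
by case: ifPn => // /set_mem; exact: f20.
Qed.

End NonmeasurableIntegral.

(** * One-sided difference quotients at interior points *)

Section Derivatives.
Variable R : realType.
Implicit Types (f g : R -> R) (x y l : R).

Lemma diff_quot_is_derive f x l :
  diff_quot f x @ x^' --> l <-> is_derive x (1 : R) f l.
Proof.
pose q (h : R) := h^-1 *: (f (h *: (1 : R) + x) - f x).
have E : q = diff_quot f x \o (fun h => h + x).
  apply/funext => h; rewrite /q /diff_quot /= [h *: 1](mulr1).
  by rewrite addrK mulrC.
split => [H|[+ <-]].
  suff K : q @ 0^' --> l.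
    by apply: DeriveDef; [apply/cvg_ex; exists l | exact/cvg_lim].
  rewrite E; apply: cvg_comp H => A /=.
  rewrite !near_simpl /dnbhs /within /= => /nbhs_ballP[e e0 xA].
  apply/nbhs_ballP; exists e => // h; rewrite /ball /= sub0r normrN => he h0.
  apply: xA; first by rewrite /ball /= opprD addrCA subrr addr0 normrN.
  by apply: contraNneq h0 => hx; rewrite -(addrK x h) hx subrr.
rewrite /derivable /derive -/q => K'.
have {K'} : q @ 0^' --> lim (q @ 0^') by [].
rewrite {1}E => K.
have -> : diff_quot f x = (diff_quot f x \o (fun h => h + x)) \o (fun y => y - x).
  by apply/funext => y; rewrite /= subrK.
apply: cvg_comp K => A /=.
rewrite !near_simpl /dnbhs /within /= => /nbhs_ballP[e e0 xA].
apply/nbhs_ballP; exists e => // h; rewrite /ball /= => he h0.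
apply: xA; first by rewrite /ball /= sub0r opprB.
by apply: contraNneq h0 => /eqP; rewrite subr_eq0.
Qed.

Lemma within_dnbhs (A : set R) x : nbhs x A -> within A x^' = x^'.
Proof.
move=> xA; apply/seteqP; split => B; rewrite /dnbhs /within /= => H.
  by apply: filterS2 xA H => y Ay /[apply]; exact.
by apply: filterS H => y By /By.
Qed.

Lemma deriv_onP (A : set R) f x : nbhs x A -> derivable_on A f x ->
  is_derive x 1 f (deriv_on A f x).
Proof.
by move=> xA df; apply/diff_quot_is_derive; rewrite -(within_dnbhs xA).
Qed.

Lemma is_derive_deriv_on (A : set R) f x l : nbhs x A ->
  is_derive x 1 f l -> deriv_on A f x = l.
Proof.
move=> xA /diff_quot_is_derive df; apply: cvg_lim; first exact: Rhausdorff.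
by rewrite (within_dnbhs xA); exact: Proper_dnbhs_numFieldType.
by rewrite (within_dnbhs xA).
Qed.

Lemma is_derive_continuous f x l : is_derive x (1 : R) f l ->
  {for x, continuous f}.
Proof. by move=> [df _]; apply: differentiable_continuous; exact/derivable1_diffP. Qed.

End Derivatives.

(** * Square integrable functions and primitives on the parameter interval *)

Section Param.
Variable R : realType.
Implicit Types (f g h m u : R -> R) (x y z : R).
Notation mu := (@lebesgue_measure R).
Notation param := (@param R).

Definition inner x := 0 < x < 2 * pi.

Lemma inner_nbhs x : inner x -> \forall y \near x, inner y.
Proof.
move=> xi; have : x \in `]0, 2 * pi[ by rewrite in_itv.
by move=> /near_in_itvoo; apply: filterS => y; rewrite in_itv.
Qed.

Lemma inner_param x : inner x -> param x.
Proof. by rewrite /Defs.param /= in_itv /= => /andP[/ltW-> /ltW->]. Qed.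

Lemma nbhs_param x : inner x -> nbhs x param.
Proof. by move=> /inner_nbhs; apply: filterS => y /inner_param. Qed.

Lemma two_pi_gt0 : 0 < 2 * pi :> R.
Proof. by rewrite mulr_gt0// pi_gt0. Qed.

Lemma measurable_param : measurable param.
Proof. exact: measurable_itv. Qed.
Hint Resolve measurable_param : core.

(** The Borel sets of the line carry two names: the canonical one, and the
sigma-algebra generated by half-open intervals on which the Lebesgue measure is
declared. *)
Lemma measurable_param_ocitv :
  measurable (param : set (g_sigma_algebraType R.-ocitv.-measurable)).
Proof. exact: measurable_itv. Qed.
Hint Resolve measurable_param_ocitv : core.

Lemma compact_param : compact param.
Proof. exact: segment_compact. Qed.

Lemma ae_inner : {ae mu, forall x, param x -> inner x}.
Proof.
exists ([set 0] `|` [set 2 * pi]); split.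
- exact: measurableU.
- apply/eqP; rewrite -measure_le0 (le_trans (measureU2 _ _ _))//.
  by rewrite [X in (X + _)%E](lebesgue_measure_set1 0)
    [X in (_ + X)%E](lebesgue_measure_set1 (2 * pi)) adde0.
- move=> x /= /not_implyP[]; rewrite /Defs.param /= in_itv /= => /andP[x0 xp].
  rewrite /inner => /negP; rewrite negb_and -!leNgt => /orP[x0'|xp'].
    by left; apply/eqP; rewrite eq_le x0 x0'.
  by right; apply/eqP; rewrite eq_le xp xp'.
Qed.

Lemma continuous_param_measurable u :
  {within param, continuous u} -> measurable_fun param u.
Proof. by apply: subspace_continuous_measurable_fun. Qed.

Lemma continuous_param_integrable u :
  {within param, continuous u} -> mu.-integrable param (EFin \o u).
Proof. by apply: continuous_compact_integrable; exact: compact_param. Qed.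

Lemma continuous_param_bounded u :
  {within param, continuous u} -> exists2 K : R, 0 < K & forall x, param x -> `|u x| <= K.
Proof.
move=> cu; have /compact_bounded[M [_ uM]] := continuous_compact cu compact_param.
exists (`|M| + 1) => [|x xp]; first by rewrite ltr_wpDl.
apply: uM; first by rewrite (le_lt_trans (ler_norm M))// ltrDl.
by exists x.
Qed.

Lemma continuous_inner u x :
  {within param, continuous u} -> inner x -> {for x, continuous u}.
Proof.
move=> /subspace_continuousP/(_ x) cu xi.
have := cu (inner_param xi).
by rewrite /continuous_at /prop_for within_interior//; exact: nbhs_param.
Qed.

Lemma continuous_cst_param (k : R) : {within param, continuous (fun=> k)}.
Proof. by apply: continuous_subspaceT => x; exact: cvg_cst. Qed.

Lemma integrable_cst_param (k : R) : mu.-integrable param (cst k%:E).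
Proof. exact: continuous_param_integrable (@continuous_cst_param k). Qed.

Lemma L2_sq_integrable g : L2 g -> mu.-integrable param (fun x => (g x ^+ 2)%:E).
Proof.
move=> [mg gfin]; apply/integrableP; split.
  by apply/measurable_EFinP; exact: measurable_funX.
by under eq_integral do rewrite /= ger0_norm ?sqr_ge0//.
Qed.

Lemma L2_integrable g : L2 g -> mu.-integrable param (EFin \o g).
Proof.
move=> gL; apply: (@le_integrable _ _ _ mu _ measurable_param _
    (fun x => 1%:E + (g x ^+ 2)%:E)%E).
- by apply/measurable_EFinP; case: gL.
- move=> x _ /=; rewrite lee_fin [leRHS]ger0_norm ?addr_ge0 ?sqr_ge0//.
  rewrite -real_normK ?num_real//.
  by have := sqr_ge0 (`|g x| - 1); nra.
- by apply: integrableD => //; [exact: integrable_cst_param|exact: L2_sq_integrable].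
Qed.

Lemma sq_integrable_L2 g : measurable_fun param g ->
  mu.-integrable param (fun x => (g x ^+ 2)%:E) -> L2 g.
Proof.
move=> mg /integrableP[_]; split=> //.
by under eq_integral do rewrite -(ger0_norm (sqr_ge0 _)) -abse_EFin//.
Qed.

Lemma L2_le g h : measurable_fun param g -> L2 h ->
  (forall x, param x -> `|g x| <= `|h x|) -> L2 g.
Proof.
move=> mg hL gh; apply: sq_integrable_L2 => //.
apply: le_integrable (L2_sq_integrable hL) => //.
  by apply/measurable_EFinP; exact: measurable_funX.
by move=> x xp; rewrite /= lee_fin !normrX lerXn2r ?nnegrE// gh.
Qed.

Lemma L2D g h : L2 g -> L2 h -> L2 (fun x => g x + h x).
Proof.
move=> gL hL; apply: sq_integrable_L2.
  by apply: measurable_funD; [case: gL|case: hL].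
apply: (@le_integrable _ _ _ mu _ measurable_param _
   (fun x => 2%:E * ((g x ^+ 2)%:E + (h x ^+ 2)%:E))%E).
- apply/measurable_EFinP/measurable_funX.
  by apply: measurable_funD; [case: gL|case: hL].
- move=> x _ /=; rewrite lee_fin !ger0_norm ?sqr_ge0 ?mulr_ge0 ?addr_ge0 ?sqr_ge0//.
  by have := sqr_ge0 (g x - h x); nra.
- by apply: integrableZl => //; apply: integrableD => //; exact: L2_sq_integrable.
Qed.

Lemma L2M u g : {within param, continuous u} -> L2 g -> L2 (fun x => u x * g x).
Proof.
move=> cu gL; have [K K0 uK] := continuous_param_bounded cu.
have mug : measurable_fun param (fun x => u x * g x).
  by apply: measurable_funM; [exact: continuous_param_measurable|case: gL].
apply: sq_integrable_L2 => //.
apply: (@le_integrable _ _ _ mu _ measurable_param _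
   (fun x => (K ^+ 2)%:E * (g x ^+ 2)%:E)%E).
- exact/measurable_EFinP/measurable_funX.
- move=> x xp /=; have uKx := uK x xp.
  rewrite lee_fin [leLHS]ger0_norm ?sqr_ge0// [leRHS]ger0_norm; last first.
    by rewrite mulr_ge0 ?sqr_ge0.
  rewrite exprMn ler_wpM2r ?sqr_ge0// -real_normK ?num_real//.
  by rewrite lerXn2r// nnegrE ltW.
- by apply: integrableZl => //; exact: L2_sq_integrable.
Qed.

Lemma L2Z (k : R) g : L2 g -> L2 (fun x => k * g x).
Proof. by apply: L2M; exact: continuous_cst_param. Qed.

Lemma L2_norm g : L2 g -> L2 (fun x => `|g x|).
Proof.
move=> gL; apply: (L2_le _ gL) => [|x _]; last by rewrite normr_id.
by apply: measurableT_comp => //; case: gL.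
Qed.

Lemma L2_cst (k : R) : L2 (fun=> k : R).
Proof.
apply: sq_integrable_L2; first exact: measurable_cst.
exact: integrable_cst_param.
Qed.

Lemma integrableDR g h : mu.-integrable param (EFin \o g) ->
  mu.-integrable param (EFin \o h) ->
  mu.-integrable param (EFin \o (fun t => g t + h t)).
Proof.
move=> gI hI; rewrite (_ : _ \o _ = (EFin \o g) \+ (EFin \o h))%E//.
exact: integrableD.
Qed.

Lemma integrableZR (k : R) g : mu.-integrable param (EFin \o g) ->
  mu.-integrable param (EFin \o (fun t => k * g t)).
Proof.
move=> gI; rewrite (_ : _ \o _ = fun t => k%:E * (EFin \o g) t)%E//.
exact: integrableZl.
Qed.

(** Restricting g to the parameter interval extends the primitive by constants on
both sides. *)
Definition prim g z := (\int[mu]_(t in `[0%R, z]) (g \_ param) t)%R.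

Lemma integrable_param_itv g x y : mu.-integrable param (EFin \o g) ->
  0 <= x -> y <= 2 * pi -> mu.-integrable `[x, y] (EFin \o g).
Proof.
move=> gI x0 y0; apply: integrableS gI => //.
by apply: subset_itv; rewrite bnd_simp.
Qed.

Lemma primB g x y : mu.-integrable param (EFin \o g) ->
  0 <= x -> x <= y -> y <= 2 * pi ->
  prim g y - prim g x = (\int[mu]_(t in `[x, y]) g t)%R.
Proof.
move=> gI x0 xy y2.
have E z : z <= 2 * pi ->
    prim g z = (\int[mu]_(t in `[0%R, z]) g t)%R.
  move=> z2; apply: eq_Rintegral => t; rewrite inE /= in_itv /= => /andP[t0 tz].
  by rewrite patchE mem_set// /Defs.param /= in_itv /= t0 (le_trans tz).
rewrite !E ?(le_trans xy)// Rintegral_itvB//.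
- rewrite Rintegral_itv_obnd_cbnd//.
  apply: (@integrableS _ _ _ mu `[x, y]) => //; last exact: integrable_param_itv.
  exact: subset_itv_oc_cc.
- exact: integrable_param_itv.
Qed.

Lemma le_prim g h x y : mu.-integrable param (EFin \o g) ->
  mu.-integrable param (EFin \o h) -> (forall t, inner t -> g t <= h t) ->
  0 < x -> x <= y -> y < 2 * pi ->
  prim g y - prim g x <= prim h y - prim h x.
Proof.
move=> gI hI gh x0 xy y2; have [x0' y2'] := (ltW x0, ltW y2).
rewrite !primB//.
apply: le_Rintegral => //; [exact: integrable_param_itv..|].
- move=> t /=; rewrite in_itv /= => /andP[xt ty]; apply: gh.
  by rewrite /inner (lt_le_trans x0)//= (le_lt_trans ty).
Qed.

Lemma primDB g h x y : mu.-integrable param (EFin \o g) ->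
  mu.-integrable param (EFin \o h) ->
  0 <= x -> x <= y -> y <= 2 * pi ->
  prim (fun t => g t + h t) y - prim (fun t => g t + h t) x =
  (prim g y - prim g x) + (prim h y - prim h x).
Proof.
move=> gI hI x0 xy y2; rewrite !primB//; last exact: integrableDR.
by rewrite RintegralD//; exact: integrable_param_itv.
Qed.

Lemma primZB (k : R) g x y : mu.-integrable param (EFin \o g) ->
  0 <= x -> x <= y -> y <= 2 * pi ->
  prim (fun t => k * g t) y - prim (fun t => k * g t) x =
  k * (prim g y - prim g x).
Proof.
move=> gI x0 xy y2; rewrite !primB//; last exact: integrableZR.
by rewrite RintegralZl//; exact: integrable_param_itv.
Qed.

Lemma integrable_patch g : mu.-integrable param (EFin \o g) ->
  mu.-integrable setT (EFin \o (g \_ param)).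
Proof.
by move=> gI; rewrite -restrict_EFin; apply/integrable_restrict => //; rewrite setTI.
Qed.

Lemma prim_continuous g : mu.-integrable param (EFin \o g) ->
  {within param, continuous (prim g)}.
Proof.
move=> gI; apply: parameterized_integral_continuous; first exact/ltW/two_pi_gt0.
exact: integrableS (integrable_patch gI).
Qed.

Lemma is_derive_prim u z : {within param, continuous u} -> inner z ->
  is_derive z (1 : R) (prim u) (u z).
Proof.
move=> cu zi; have /andP[z0 z2] := zi.
have uI := integrable_patch (continuous_param_integrable cu).
have uz : (u \_ param) z = u z by rewrite patchE mem_set//; exact: inner_param.
have [|//||] := @continuous_FTC1_closed R (u \_ param) 0 z (2 * pi) z2.
- exact: integrableS uI.
- have := continuous_inner cu zi; rewrite /prop_for /continuous_at uz.
  apply: cvg_trans; apply: near_eq_cvg.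
  move: (nbhs_param zi); apply: filterS => t tp.
  by rewrite patchE mem_set.
- by move=> dF; rewrite derive1E uz => <-; exact: derivableP.
Qed.

(** Lebesgue differentiation theorem. *)
Lemma ae_is_derive_prim g : mu.-integrable param (EFin \o g) ->
  {ae mu, forall x, inner x -> is_derive x (1 : R) (prim g) (g x)}.
Proof.
move=> gI; have gT := integrable_patch gI.
have gI' y : mu.-integrable `[0, y] (EFin \o (g \_ param)).
  exact: integrableS gT.
have := @FTC1 R (g \_ param) (BLeft 0) gI'.
move=> /(_ (open_integrable_locally openT gT)).
apply: filterS; first exact: (ae_filter_ringOfSetsType mu).
move=> x Hx xi; have /andP[x0 _] := xi.
have [|] := Hx; first by rewrite lte_fin.
rewrite derive1E patchE mem_set; last exact: inner_param.
by move=> dx <-; exact: derivableP.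
Qed.

End Param.

(** * The derivative of a monotone function *)

Section AbsCont.
Variable R : realType.
Implicit Types (f g h m u : R -> R) (x y z : R).
Notation mu := (@lebesgue_measure R).
Notation param := (@param R).
Hint Resolve measurable_param measurable_param_ocitv : core.

(** An infinitesimal sequence whose terms are all as small as desired, by the
choice of N. *)
Definition step N n : R := ((n + N).+1%:R)^-1.

Lemma step_gt0 N n : 0 < step N n.
Proof. by rewrite invr_gt0. Qed.

Lemma step_lt (e : R) : 0 < e -> exists N, forall n, step N n < e.
Proof.
move=> e0; have := near_infty_natSinv_lt (PosNum e0) => -[N _ HN].
exists N => n; apply: HN => /=; exact: leq_addl.
Qed.

Lemma cvg_step N : step N n @[n --> \oo] --> 0.
Proof. by have := @cvg_harmonic R; rewrite -(cvg_shiftn N). Qed.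

Lemma derive_step N f x l : is_derive x (1 : R) f l ->
  (f (x + step N n) - f x) / step N n @[n --> \oo] --> l.
Proof.
move=> /diff_quot_is_derive fl.
have -> : (fun n => (f (x + step N n) - f x) / step N n) =
          diff_quot f x \o (fun n => x + step N n).
  by apply/funext => n; rewrite /diff_quot /= addrAC subrr add0r.
apply: cvg_comp fl => A /=; rewrite /dnbhs /within /= => /nbhs_ballP[e e0 xA].
have /cvgrPdist_lt/(_ e e0)[M _ HM] := @cvg_step N.
exists M => // n /HM /=; rewrite sub0r normrN => hn; apply: xA.
  by rewrite /ball /= opprD addrA subrr add0r normrN.
by rewrite -subr_eq0 addrAC subrr add0r gt_eqF// step_gt0.
Qed.

Lemma continuous_itv (u : R -> R) x y :
  (forall z, x <= z <= y -> {for z, continuous u}) ->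
  {within `[x, y], continuous u}.
Proof.
move=> cu; apply: continuous_in_subspaceT => z; rewrite inE /= in_itv /=.
exact: cu.
Qed.

Lemma ftc_itv F u x y : x < y -> {within `[x, y], continuous u} ->
  (forall z, x <= z <= y -> is_derive z (1 : R) F (u z)) ->
  (\int[mu]_(t in `[x, y]) (u t)%:E = (F y - F x)%:E)%E.
Proof.
move=> xy cu dF; rewrite (@continuous_FTC2 R u F)//; last first.
  move=> z; rewrite in_itv /= => /andP[xz zy]; rewrite derive1E.
  by have [|_ ->//] := dF z; rewrite !ltW.
have cF z : x <= z <= y -> {for z, continuous F}.
  by move=> /dF; exact: is_derive_continuous.
split.
- move=> z; rewrite in_itv /= => /andP[xz zy].
  by have [|//] := dF z; rewrite !ltW.
- by apply: cvg_at_right_filter; apply: cF; rewrite lexx ltW.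
- by apply: cvg_at_left_filter; apply: cF; rewrite lexx ltW.
Qed.

Lemma inner_itv x y z : 0 < x -> y < 2 * pi -> x <= z <= y -> inner z.
Proof.
by move=> x0 y2 /andP[xz zy]; rewrite /inner (lt_le_trans x0)//= (le_lt_trans zy).
Qed.

Lemma limn_einf_ge0 (v : (\bar R)^nat) : (forall n, (0 <= v n)%E) ->
  (0 <= limn_einf v)%E.
Proof.
move=> v0; rewrite limn_einf_lim; apply: lime_ge; first exact: is_cvg_einfs.
by apply: nearW => n; apply: le_ereal_inf_tmp => _ [k /= _ <-].
Qed.

(** The inequality of Lebesgue for monotone functions.  The difference quotients
of P with step 1 / n are nonnegative and converge almost everywhere to p; their
integral over [x, y] telescopes to a difference of averages of P near y and near
x, which converges to P y - P x.  Fatou's lemma concludes. *)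
Lemma nondecreasing_prim_le (P p : R -> R) x y :
  {within param, continuous P} ->
  (forall s t, 0 < s -> s <= t -> t < 2 * pi -> P s <= P t) ->
  mu.-integrable param (EFin \o p) ->
  {ae mu, forall s, inner s -> is_derive s (1 : R) P (p s)} ->
  0 < x -> x < y -> y < 2 * pi ->
  prim p y - prim p x <= P y - P x.
Proof.
move=> cP ndP pI dP x0 xy y2.
have [N hN] : exists N, forall n, step N n < 2 * pi - y.
  by apply: step_lt; rewrite subr_gt0.
pose h n := step N n.
have h0 n : 0 < h n by exact: step_gt0.
have hy n : y + h n < 2 * pi by rewrite addrC -ltrBrDr; exact: hN.
pose q n s := (P (s + h n) - P s) / h n.
have xyi s : x <= s <= y -> inner s by exact: inner_itv.
have xyhi n s : x <= s <= y -> inner (s + h n).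
  move=> /andP[xs sy]; apply: (@inner_itv x (y + h n)) => //.
  by rewrite lerD2r sy andbT ler_wpDr// ltW.
have dQ s : inner s -> is_derive s (1 : R) (prim P) (P s).
  exact: is_derive_prim.
pose F n s := (prim P (s + h n) - prim P s) / h n.
have dF n s : x <= s <= y -> is_derive s (1 : R) (F n) (q n s).
  move=> xsy.
  have d1 : is_derive s (1 : R) (fun s => prim P (s + h n)) (P (s + h n)).
    have := @is_derive1_comp _ (prim P) (shift (h n)) s _ _ (dQ _ (xyhi n s xsy))
      (is_derive_shift s 1 (h n)).
    by rewrite mulr1.
  have d2 := is_deriveB d1 (dQ _ (xyi s xsy)).
  have := is_deriveZ ((h n)^-1) d2.
  rewrite (_ : _ \*: _ = F n); last first.
    by apply/funext => t; rewrite /F mulrC.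
  by rewrite (_ : _ *: _ = q n s)// /q mulrC.
have cq n : {within `[x, y], continuous (q n)}.
  apply: continuous_itv => s xsy.
  apply: (@continuousM _ _ (fun s => P (s + h n) - P s) (cst (h n)^-1)); last exact: cvg_cst.
  apply: (@continuousB _ _ _ (P \o shift (h n)) P).
    apply: continuous_comp; last exact: continuous_inner (xyhi n s xsy).
    by apply: continuousD; [exact: cvg_id|exact: cvg_cst].
  exact: continuous_inner (xyi s xsy).
have q0 n s : x <= s <= y -> 0 <= q n s.
  move=> xsy; apply: divr_ge0; last exact: ltW.
  rewrite subr_ge0; apply: ndP.
  - by have /andP[] := xyi s xsy.
  - by rewrite lerDl ltW.
  - by have /andP[] := xyhi n s xsy.
have xyE (s : R) : `[x, y]%classic s -> x <= s <= y by rewrite /= in_itv.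
have Fcvg s : inner s -> F n s @[n --> \oo] --> P s.
  by move=> /dQ dPs; exact: (@derive_step N _ _ _ dPs).
have := @fatou _ _ _ mu `[x, y]%classic (measurable_itv _) (fun n s => (q n s)%:E).
move=> /(_ (fun n => iffRL (measurable_EFinP _ _)
  (subspace_continuous_measurable_fun (measurable_itv _) (cq n)))).
move=> /(_ (fun n s xys => q0 n s (xyE s xys))).
(* F n is a primitive of the difference quotient q n. *)
have -> : (fun n => \int[mu]_(s in `[x, y]) (q n s)%:E)%E = (fun n => (F n y - F n x)%:E).
  by apply/funext => n; exact: (ftc_itv xy (cq n) (dF n)).
have -> : limn_einf (fun n => (F n y - F n x)%:E) = (P y - P x)%:E.
  apply: (cvg_limn_einf_sup _).1; apply: cvg_EFin; first by near=> n.
  by apply: cvgB; apply: Fcvg; apply: xyi; rewrite lexx ltW.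
move=> fat.
have pxyI : mu.-integrable `[x, y] (EFin \o p).
  by apply: integrable_param_itv => //; exact: ltW.
have x0' := ltW x0; have xy' := ltW xy; have y2' := ltW y2.
rewrite primB//.
apply: le_trans (ler_norm _) _; apply: le_trans (le_normr_Rintegral _ pxyI) _ => //.
rewrite -lee_fin fineK; last first.
  by apply: integrable_fin_num => //; exact: integrable_norm.
apply: le_trans fat; apply: ge0_ae_le_integral_subset => //.
- move=> s /xyE xsy; apply: limn_einf_ge0 => n; exact: q0.
move: dP; apply: filterS; first exact: (ae_filter_ringOfSetsType mu).
move=> s dP /xyE xsy.
have qcvg : q n s @[n --> \oo] --> p s by apply: derive_step; apply: dP; exact: xyi.
have p0 : 0 <= p s by apply: (cvgr_to_ge qcvg); apply: nearW => n; exact: q0.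
rewrite ger0_norm//.
rewrite (_ : limn_einf _ = (p s)%:E)//.
apply: (cvg_limn_einf_sup _).1; apply: cvg_EFin => //; by near=> n.
Unshelve. all: by end_near. Qed.
End AbsCont.

(** * Absolutely continuous functions with square integrable derivative *)

Section AbsCont2.
Variable R : realType.
Implicit Types (f g h m u k q : R -> R) (x y z : R).
Notation mu := (@lebesgue_measure R).
Notation param := (@param R).
Hint Resolve measurable_param measurable_param_ocitv : core.

(** On continuous representatives this is membership in H^1, with derivative g.
Only increments between interior points are recorded; the end points follow by
continuity. *)
Definition abs_cont f g :=
  [/\ {within param, continuous f}, L2 g &
   forall x y, inner x -> inner y -> f y - f x = prim g y - prim g x].

Lemma abs_cont_ae f g : abs_cont f g ->
  {ae mu, forall x, inner x -> is_derive x (1 : R) f (g x)}.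
Proof.
move=> [_ gL fg]; have := ae_is_derive_prim (L2_integrable gL).
apply: filterS; first exact: (ae_filter_ringOfSetsType mu).
move=> x /[swap] xi /(_ xi) dg.
have d1 := is_deriveD dg (is_derive_cst (f x - prim g x) x 1).
rewrite addr0 in d1; apply: near_eq_is_derive d1.
move: (inner_nbhs xi); apply: filterS => y yi /=.
by have /= := fg _ _ xi yi => fE; rewrite -[RHS](subrK (f x)) fE !fctE; ring.
Qed.

Lemma within_continuousD f g : {within param, continuous f} ->
  {within param, continuous g} -> {within param, continuous (fun x => f x + g x)}.
Proof. by move=> cf cg x; apply: continuousD; [exact: cf|exact: cg]. Qed.

Lemma within_continuousM f g : {within param, continuous f} ->
  {within param, continuous g} -> {within param, continuous (fun x => f x * g x)}.
Proof. by move=> cf cg x; apply: continuousM; [exact: cf|exact: cg]. Qed.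

Lemma within_continuousN f : {within param, continuous f} ->
  {within param, continuous (fun x => - f x)}.
Proof. by move=> cf x; apply: continuousN; exact: cf. Qed.

(** prim m + f is nondecreasing with derivative m + g almost everywhere, so
nondecreasing_prim_le applies to it, and the contribution of m cancels. *)
Lemma prim_le_of_drop f g m x y :
  {within param, continuous f} ->
  mu.-integrable param (EFin \o g) -> mu.-integrable param (EFin \o m) ->
  (forall s t, 0 < s -> s <= t -> t < 2 * pi ->
     f s - f t <= prim m t - prim m s) ->
  {ae mu, forall s, inner s -> is_derive s (1 : R) f (g s)} ->
  0 < x -> x < y -> y < 2 * pi ->
  prim g y - prim g x <= f y - f x.
Proof.
move=> cf gI mI dom df x0 xy y2.
have := @nondecreasing_prim_le R (fun s => prim m s + f s) (fun s => m s + g s) x y.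
have x0' := ltW x0; have xy' := ltW xy; have y2' := ltW y2.
rewrite (primDB mI gI)// => H.
suff : prim m y - prim m x + (prim g y - prim g x) <=
       prim m y + f y - (prim m x + f x) by lra.
apply: H => //.
- by apply: within_continuousD => //; exact: prim_continuous.
- by move=> s t s0 st t2; have := dom s t s0 st t2; lra.
- exact: integrableDR.
- move: df (ae_is_derive_prim mI); apply: filterS2.
    exact: (ae_filter_ringOfSetsType mu).
  by move=> s dfs dms si; exact: (is_deriveD (dms si) (dfs si)).
Qed.

(** The domination by m excludes a singular part: both f and - f satisfy
prim_le_of_drop, and the two inequalities give equality. *)
Lemma abs_cont_intro f g m :
  {within param, continuous f} -> L2 g -> L2 m ->
  (forall s t, 0 < s -> s <= t -> t < 2 * pi ->
     `|f t - f s| <= prim m t - prim m s) ->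
  {ae mu, forall s, inner s -> is_derive s (1 : R) f (g s)} ->
  abs_cont f g.
Proof.
move=> cf gL mL dom df; split=> //.
have [gI mI] := (L2_integrable gL, L2_integrable mL).
suff H x y : 0 < x -> x < y -> y < 2 * pi -> f y - f x = prim g y - prim g x.
  move=> x y /andP[x0 x2] /andP[y0 y2]; have [xy|yx|->] := ltgtP x y.
  - exact: H.
  - by have := H _ _ y0 yx x2; lra.
  - by rewrite !subrr.
move=> x0 xy y2; apply/eqP; rewrite eq_le; apply/andP; split; last first.
  apply: (prim_le_of_drop cf gI mI) => // s t s0 st t2.
  by have := dom s t s0 st t2; rewrite ler_norml; lra.
have gNI := integrableZR (-1) gI.
have := @prim_le_of_drop (fun s => - f s) (fun s => -1 * g s) m x y.
have x0' := ltW x0; have xy' := ltW xy; have y2' := ltW y2.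
rewrite (primZB _ gI)// => H.
suff : -1 * (prim g y - prim g x) <= - f y - - f x by lra.
apply: H => //.
- exact: within_continuousN.
- move=> s t s0 st t2.
  by have := dom s t s0 st t2; rewrite ler_norml; lra.
- move: df; apply: filterS; first exact: (ae_filter_ringOfSetsType mu).
  by move=> s dfs si; rewrite mulN1r; exact: (is_deriveN (dfs si)).
Qed.

Lemma abs_cont_dom f g s t : abs_cont f g -> 0 < s -> s <= t -> t < 2 * pi ->
  `|f t - f s| <= prim (fun x => `|g x|) t - prim (fun x => `|g x|) s.
Proof.
move=> [_ gL fg] s0 st t2.
have gI := L2_integrable gL; have ngI := L2_integrable (L2_norm gL).
have s0' := ltW s0; have t2' := ltW t2.
rewrite fg /inner ?s0 ?t2 ?(lt_le_trans s0)// ?(le_lt_trans st)//.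
rewrite !primB//; apply: le_normr_Rintegral => //.
exact: integrable_param_itv.
Qed.

Lemma abs_contM f g k q : abs_cont f g -> abs_cont k q ->
  abs_cont (fun x => f x * k x) (fun x => f x * q x + k x * g x).
Proof.
move=> fg kq; have [cf gL _] := fg; have [ck qL _] := kq.
have [K K0 fK] := continuous_param_bounded cf.
have [K' K'0 kK] := continuous_param_bounded ck.
have ngL := L2_norm gL; have nqL := L2_norm qL.
apply: (@abs_cont_intro _ _ (fun x => K * `|q x| + K' * `|g x|)).
- exact: within_continuousM.
- by apply: L2D; exact: L2M.
- by apply: L2D; exact: L2Z.
- move=> s t s0 st t2; have s0' := ltW s0; have t2' := ltW t2.
  have [si ti] : inner s /\ inner t.
    by rewrite /inner s0 t2 (lt_le_trans s0)// (le_lt_trans st).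
  have [ngI nqI] := (L2_integrable ngL, L2_integrable nqL).
  rewrite (primDB (integrableZR K nqI) (integrableZR K' ngI))//.
  rewrite (primZB _ nqI)// (primZB _ ngI)//.
  have -> : f t * k t - f s * k s = f t * (k t - k s) + k s * (f t - f s) by ring.
  rewrite (le_trans (ler_normD _ _))// !normrM lerD// ler_pM//.
  + exact/fK/inner_param.
  + exact: abs_cont_dom kq s0 st t2.
  + exact/kK/inner_param.
  + exact: abs_cont_dom fg s0 st t2.
- move: (abs_cont_ae fg) (abs_cont_ae kq); apply: filterS2.
    exact: (ae_filter_ringOfSetsType mu).
  by move=> s df dk si; exact: (is_deriveM (df si) (dk si)).
Qed.

(** Chain rule; the Lipschitz bound provides the domination. *)
Lemma abs_cont_comp u g (F F' : R -> R) (K : R) : abs_cont u g ->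
  {within param, continuous (F \o u)} -> {within param, continuous (F' \o u)} ->
  (forall x y, inner x -> inner y -> `|F (u y) - F (u x)| <= K * `|u y - u x|) ->
  (forall x, inner x -> is_derive (u x) (1 : R) F (F' (u x))) ->
  abs_cont (fun x => F (u x)) (fun x => F' (u x) * g x).
Proof.
move=> ug cF cF' lipF dF; have [cu gL _] := ug; have ngL := L2_norm gL.
apply: (@abs_cont_intro _ _ (fun x => `|K| * `|g x|)) => //.
- by apply: (L2M cF').
- exact: L2Z.
- move=> s t s0 st t2; have s0' := ltW s0; have t2' := ltW t2.
  rewrite primZB//; last exact: L2_integrable.
  rewrite (le_trans (lipF _ _ _ _)) /inner ?s0 ?t2 ?(lt_le_trans s0)// ?(le_lt_trans st)//.
  rewrite (le_trans (ler_wpM2r _ (ler_norm K)))// ler_wpM2l//.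
  exact: abs_cont_dom ug s0 st t2.
- move: (abs_cont_ae ug); apply: filterS; first exact: (ae_filter_ringOfSetsType mu).
  by move=> s du si; exact: (is_derive1_comp (dF _ si) (du si)).
Qed.

Lemma within_continuous_sum (I : Type) (r : seq I) (F : I -> R -> R) :
  (forall i, {within param, continuous (F i)}) ->
  {within param, continuous (fun x => \sum_(i <- r) F i x)}.
Proof.
move=> FL; elim: r => [|i r IH].
  by under eq_fun do rewrite big_nil; exact: continuous_cst_param.
by under eq_fun do rewrite big_cons; apply: within_continuousD.
Qed.

Lemma abs_contD f g k q : abs_cont f g -> abs_cont k q ->
  abs_cont (fun x => f x + k x) (fun x => g x + q x).
Proof.
move=> fg kq; have [cf gL fE] := fg; have [ck qL kE] := kq.
split; [exact: within_continuousD|exact: L2D|].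
suff H x y : inner x -> inner y -> x <= y -> f y + k y - (f x + k x) =
    prim (fun x0 => g x0 + q x0) y - prim (fun x0 => g x0 + q x0) x.
  move=> x y xi yi; have [xy|/ltW yx] := leP x y; first exact: H.
  by have := H _ _ yi xi yx; lra.
move=> xi yi xy; have /andP[x0 _] := xi; have /andP[_ y2] := yi.
have x0' := ltW x0; have y2' := ltW y2.
rewrite (primDB (L2_integrable gL) (L2_integrable qL))// -fE// -kE//.
by ring.
Qed.

Lemma abs_cont_cst (c : R) : abs_cont (fun=> c) (fun=> 0).
Proof.
split; [exact: continuous_cst_param|exact: L2_cst|move=> x y _ _].
rewrite subrr /prim.
have -> : (fun=> 0) \_ param = cst 0 :> (R -> R).
  by apply/funext => t; rewrite patchE; case: ifP.
by rewrite /Rintegral !integral0 subrr.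
Qed.

Lemma abs_cont_sum (I : Type) (r : seq I) (F G : I -> R -> R) :
  (forall i, abs_cont (F i) (G i)) ->
  abs_cont (fun x => \sum_(i <- r) F i x) (fun x => \sum_(i <- r) G i x).
Proof.
move=> FG; elim: r => [|i r IH].
  under eq_fun do rewrite big_nil; under [in X in _ X]eq_fun do rewrite big_nil.
  exact: abs_cont_cst.
under eq_fun do rewrite big_cons; under [in X in _ X]eq_fun do rewrite big_cons.
exact: abs_contD.
Qed.

(** By compactness u is bounded away from 0, where the inverse square root is
smooth and Lipschitz. *)
Lemma abs_cont_invsqrt u g : abs_cont u g -> (forall x, param x -> 0 < u x) ->
  exists q, abs_cont (fun x => (Num.sqrt (u x))^-1) q.
Proof.
move=> ug u0; have [cu gL _] := ug.
have [a aP aE] := EVT_min (ltW (two_pi_gt0 R)) cu.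
have ua : 0 < u a by exact: u0.
have uge x : param x -> u a <= u x by move=> xp; apply: aE.
pose F r : R := (Num.sqrt r)^-1.
pose F' r : R := - (Num.sqrt r) ^- 2 * (2 * Num.sqrt r)^-1.
exists (fun x => F' (u x) * g x).
have csqrt : {within param, continuous (fun x => Num.sqrt (u x))}.
  by move=> x; apply: continuous_comp; [exact: cu|exact: sqrt_continuous].
have cF : {within param, continuous (F \o u)}.
  apply/subspace_continuousP => x xp /=; apply: cvgV.
    by rewrite gt_eqF// sqrtr_gt0 u0.
  by have /subspace_continuousP := csqrt; exact.
apply: (@abs_cont_comp u g F F' ((Num.sqrt (u a))^-1 ^+ 3) ug cF).
- have -> : F' \o u = fun x => - (F (u x) * F (u x) * (2^-1 * F (u x))).
    by apply/funext => x; rewrite /F' /F /= expr2 !invfM mulNr.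
  apply: within_continuousN; apply: within_continuousM.
    exact: within_continuousM.
  by apply: within_continuousM => //; exact: continuous_cst_param.
- move=> x y xi yi.
  have := ler_wsqrtr (uge _ (inner_param xi)).
  have := ler_wsqrtr (uge _ (inner_param yi)).
  have [ux uy] : 0 < u x /\ 0 < u y by split; apply/u0/inner_param.
  rewrite -[in X in _ <= _ * `|X|](sqr_sqrtr (ltW ux))
    -[in X in _ <= _ * `|X|](sqr_sqrtr (ltW uy)).
  rewrite /F.
  have : 0 < Num.sqrt (u a) by rewrite sqrtr_gt0.
  move: (Num.sqrt (u a)) (Num.sqrt (u x)) (Num.sqrt (u y)) => b r t b0 bt br.
  have [r0 t0] : 0 < r /\ 0 < t by split; apply: lt_le_trans b0 _.
  have -> : t^-1 - r^-1 = - ((t - r) * (r^-1 * t^-1)) by field; rewrite !gt_eqF.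
  have -> : t ^+ 2 - r ^+ 2 = (t - r) * (t + r) by ring.
  rewrite normrN !normrM [leRHS]mulrCA ler_wpM2l// !gtr0_norm ?invr_gt0 ?addr_gt0//.
  (* |1/t - 1/r| = |t - r| / (r t) and 1 <= (t + r) / b. *)
  have br1 : r^-1 <= b^-1 by rewrite lef_pV2.
  have bt1 : t^-1 <= b^-1 by rewrite lef_pV2.
  have bb : 1 <= b^-1 * (t + r).
    by rewrite ler_pdivlMl// mulr1 (le_trans bt)// lerDl ltW.
  have [r1 t1 b1] : [/\ 0 <= r^-1, 0 <= t^-1 & 0 <= b^-1].
    by split; rewrite invr_ge0 ltW.
  rewrite exprS expr2 -!mulrA; apply: ler_pM => //.
  by apply: (le_trans bt1); rewrite ler_peMr.
- move=> x xi; have ux : 0 < u x by exact/u0/inner_param.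
  apply: is_deriveV; first by rewrite gt_eqF// sqrtr_gt0.
  exact: is_derive1_sqrt.
Qed.

End AbsCont2.

(** * Functions with a weak derivative are absolutely continuous *)

Section DuBoisReymond.
Variable R : realType.
Implicit Types (f g h m u k q : R -> R) (x y z t e : R).
Notation mu := (@lebesgue_measure R).
Notation param := (@param R).
Hint Resolve measurable_param measurable_param_ocitv : core.

Definition pos t : R := Num.max t 0.

Lemma posE t : (0 <= t /\ pos t = t) \/ (t <= 0 /\ pos t = 0).
Proof.
by rewrite /pos; have [t0|t0] := leP t 0; [right|left]; rewrite ?(ltW t0).
Qed.

Lemma pos_continuous : continuous pos.
Proof.
move=> t; apply: (@continuous_max _ _ id (cst 0)); [exact: cvg_id|exact: cvg_cst].
Qed.

(** The square of the positive part is C^1; translates of it are the building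
blocks of the test functions below. *)
Lemma is_derive_sqr_pos t : is_derive t (1 : R) (fun s => pos s ^+ 2) (2 * pos t).
Proof.
have [t0|t0|t0] := ltgtP t 0.
- rewrite [pos t]max_r ?ltW// mulr0.
  apply: (@near_eq_is_derive _ _ _ (cst 0)) => //.
  near=> s; rewrite /pos max_r /= ?expr0n//.
  by apply/ltW; near: s; exact: lt_nbhsl.
- rewrite [pos t]max_l ?ltW//.
  have d := is_deriveM (is_derive_id t (1 : R)) (is_derive_id t (1 : R)).
  have -> : 2 * t = t *: (1 : R) + t *: (1 : R).
    by rewrite [_ *: _]mulr1 mulr_natl mulr2n.
  apply: near_eq_is_derive d.
  near=> s; rewrite /pos max_l ?expr2//.
  by apply/ltW; near: s; exact: lt_nbhsr.
- have p0 : pos 0 = 0 :> R by rewrite /pos maxxx.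
  rewrite t0 p0 mulr0; apply/diff_quot_is_derive.
  apply/cvgrPdist_le => e e0; near=> s.
  rewrite /diff_quot p0 expr0n /= subr0 subr0 sub0r normrN.
  have s0 : s != 0 by near: s; exact: nbhs_dnbhs_neq.
  have [[_ ->]|[_ ->]] := posE s; last by rewrite expr0n mul0r normr0 ltW.
  rewrite expr2 mulfK//.
  by near: s; apply: dnbhs0_le.
Unshelve. all: by end_near. Qed.

(** The tent of integral 1 on [0, 1], written as a second difference of positive
parts. *)
Definition hat t : R := 4 * (pos t - 2 * pos (t - 2^-1) + pos (t - 1)).
(** The primitive of hat: a C^1 step from 0 to 1 across [0, 1]. *)
Definition ramp t : R :=
  2 * (pos t ^+ 2 - 2 * pos (t - 2^-1) ^+ 2 + pos (t - 1) ^+ 2).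

Lemma is_derive_ramp t : is_derive t (1 : R) ramp (hat t).
Proof.
have d c : is_derive t (1 : R) (fun s => pos (s - c) ^+ 2) (2 * pos (t - c)).
  have := @is_derive1_comp _ (fun s => pos s ^+ 2) (shift (- c)) t _ _
    (is_derive_sqr_pos _) (is_derive_shift t 1 (- c)).
  by rewrite mulr1.
have := is_deriveZ 2 (is_deriveD (is_deriveB (is_derive_sqr_pos t)
   (is_deriveZ 2 (d 2^-1))) (d 1)).
have -> : hat t = 2 *: (2 * pos t - 2 *: (2 * pos (t - 2^-1)) + 2 * pos (t - 1)).
  by rewrite /hat /GRing.scale /=; ring.
by apply: near_eq_is_derive; near=> s.
Unshelve. all: by end_near. Qed.

Lemma ramp_le0 t : t <= 0 -> ramp t = 0.
Proof.
move=> t0; rewrite /ramp /pos !max_r; last by []; rewrite ?expr0n /=; lra.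
Qed.

Lemma ramp_ge1 t : 1 <= t -> ramp t = 1.
Proof.
move=> t1; rewrite /ramp /pos !max_l; try lra; field.
Qed.

Lemma ramp_itv t : 0 <= ramp t <= 1.
Proof.
rewrite /ramp.
by have [[? ->]|[? ->]] := posE t; have [[? ->]|[? ->]] := posE (t - 2^-1);
  have [[? ->]|[? ->]] := posE (t - 1); nra.
Qed.

Lemma hat_ge0 t : 0 <= hat t.
Proof.
rewrite /hat.
by have [[? ->]|[? ->]] := posE t; have [[? ->]|[? ->]] := posE (t - 2^-1);
  have [[? ->]|[? ->]] := posE (t - 1); nra.
Qed.

Lemma hat_out t : ~~ (0 <= t <= 1) -> hat t = 0.
Proof.
move=> t01; have {t01} : t < 0 \/ 1 < t.
  by move: t01; rewrite negb_and -!ltNge => /orP[]; [left|right].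
move=> t01; rewrite /hat.
by have [[? ->]|[? ->]] := posE t; have [[? ->]|[? ->]] := posE (t - 2^-1);
  have [[? ->]|[? ->]] := posE (t - 1); case: t01 => ?; lra.
Qed.

Lemma hat_continuous : continuous hat.
Proof.
have c (a : R) : continuous (fun t : R => pos (t - a)).
  move=> t; apply: (@continuous_comp _ _ _ (fun t => t - a) pos); last exact: pos_continuous.
  by apply: continuousB; [exact: cvg_id|exact: cvg_cst].
move=> t; rewrite /hat; apply: cvgM; first exact: cvg_cst.
apply: cvgD; last exact: c.
apply: cvgB; first exact: pos_continuous.
by apply: cvgM; [exact: cvg_cst|exact: c].
Qed.

(** An approximation of the Dirac mass at x, supported by [x, x + e]. *)
Definition bump e x t : R := hat ((t - x) / e) / e.

Lemma is_derive_bump e x t :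
  is_derive t (1 : R) (fun s => ramp ((s - x) / e)) (bump e x t).
Proof.
have d1 : is_derive t (1 : R) (fun s => (s - x) / e) e^-1.
  have := is_deriveZ (e^-1) (is_derive_shift t 1 (- x)).
  have -> : e^-1 *: (1 : R) = e^-1 by exact: mulr1.
  by apply: near_eq_is_derive; near=> s; rewrite mulrC.
exact: (is_derive1_comp (is_derive_ramp _) d1).
Unshelve. all: by end_near. Qed.

Lemma bump_continuous e x : continuous (bump e x).
Proof.
move=> t; rewrite /bump; apply: cvgM; last exact: cvg_cst.
apply: (@continuous_comp _ _ _ (fun t => (t - x) / e) (@hat)); last exact: hat_continuous.
apply: cvgM; last exact: cvg_cst.
by apply: cvgB; [exact: cvg_id|exact: cvg_cst].
Qed.

Lemma bump_ge0 e x t : 0 < e -> 0 <= bump e x t.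
Proof. by move=> e0; rewrite mulr_ge0 ?hat_ge0// invr_ge0 ltW. Qed.

Lemma bump_out e x t : 0 < e -> ~~ (x <= t <= x + e) -> bump e x t = 0.
Proof.
move=> e0 xte; rewrite /bump hat_out ?mul0r//.
by rewrite ler_pdivlMr// mul0r subr_ge0 ler_pdivrMr// mul1r lerBlDl.
Qed.

Lemma integral_bump e x : 0 < e -> 0 < x -> x + e < 2 * pi ->
  (\int[mu]_(t in param) bump e x t)%R = 1.
Proof.
move=> e0 x0 xe2; rewrite /Rintegral.
have -> : (\int[mu]_(t in param) (bump e x t)%:E =
   (ramp ((2 * pi - x) / e) - ramp ((0 - x) / e))%:E)%E.
  apply: (@ftc_itv R (fun s => ramp ((s - x) / e)) (bump e x)).
  - exact: two_pi_gt0.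
  - by apply: continuous_subspaceT; exact: bump_continuous.
  - by move=> z _; exact: is_derive_bump.
rewrite /= ramp_ge1 ?ramp_le0 ?subr0//.
  by rewrite ler_pdivrMr// mul0r; lra.
by rewrite ler_pdivlMr// mul1r; lra.
Qed.

Lemma bump_approx f x d : {within param, continuous f} -> inner x -> 0 < d ->
  exists2 e0, 0 < e0 & forall e, 0 < e -> e < e0 ->
   `|(\int[mu]_(t in param) (f t * bump e x t))%R - f x| <= d.
Proof.
move=> cf xi d0; have /andP[x0 x2] := xi.
have /cvgrPdist_le/(_ d d0)/nbhs_ballP[r r0 xr] := continuous_inner cf xi.
exists (Num.min r (2 * pi - x)); first by rewrite lt_min subr_gt0 x2 andbT.
move=> e e0; rewrite lt_min => /andP[er ex].
have cb : {within param, continuous (bump e x)}.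
  by apply: continuous_subspaceT; exact: bump_continuous.
have bI := continuous_param_integrable cb.
have fbI := continuous_param_integrable (within_continuousM cf cb).
have xe2 : x + e < 2 * pi by lra.
have -> : f x = (\int[mu]_(t in param) (f x * bump e x t))%R.
  by rewrite RintegralZl// integral_bump// mulr1.
rewrite -RintegralB//; last exact: integrableZR.
have I3 : mu.-integrable param (EFin \o (fun t => f t * bump e x t - f x * bump e x t)).
  rewrite (_ : (fun t => _) = fun t => f t * bump e x t + -1 * (f x * bump e x t)); last first.
    by apply/funext => t; rewrite mulN1r.
  by apply: integrableDR => //; do 2 apply: integrableZR.
apply: le_trans (le_normr_Rintegral _ I3) _ => //.
have -> : d = (\int[mu]_(t in param) (d * bump e x t))%R.
  by rewrite RintegralZl// integral_bump// mulr1.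
apply: le_Rintegral => //.
- exact: integrable_norm.
- exact: integrableZR.
- move=> t _; rewrite -mulrBl normrM [in leLHS](ger0_norm (bump_ge0 _ _ e0)).
  have [xte|xte] := boolP (x <= t <= x + e); last by rewrite bump_out// !mulr0.
  rewrite ler_wpM2r ?bump_ge0// distrC; apply: xr.
  by rewrite /ball /= ltr_norml; move: xte => /andP[]; lra.
Qed.

(** The test function rises from 0 to 1 near x and falls back to 0 near y; its
derivative is a difference of two bumps. *)
Lemma weak_derivative_bump f g e x y : weak_derivative f g -> 0 < e ->
  0 < x -> x < y -> y + e < 2 * pi ->
  {within param, continuous f} ->
  (\int[mu]_(t in param) (f t * bump e x t))%R -
  (\int[mu]_(t in param) (f t * bump e y t))%R =
  - (\int[mu]_(t in param) (g t * (ramp ((t - x) / e) - ramp ((t - y) / e))))%R.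
Proof.
move=> fg e0 x0 xy ye2 cf.
pose phi t := ramp ((t - x) / e) - ramp ((t - y) / e).
have dphi t : is_derive t (1 : R) phi (bump e x t - bump e y t).
  exact: (is_deriveB (is_derive_bump e x t) (is_derive_bump e y t)).
have phi'E : derive1 phi = fun t => bump e x t - bump e y t.
  by apply/funext => t; rewrite derive1E; have [_ ->] := dphi t.
have cb z : {within param, continuous (bump e z)}.
  by apply: continuous_subspaceT; exact: bump_continuous.
rewrite -(fg phi); last first.
  split.
  - by move=> t; have [] := dphi t.
  - rewrite phi'E => t; apply: continuousB; exact: bump_continuous.
  - exists x, (y + e); split => // t; rewrite in_itv /= negb_and -!ltNge.
    move=> /orP[tx|ty]; rewrite /phi.
      by rewrite !ramp_le0 ?subrr// ler_pdivrMr// mul0r; lra.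
    by rewrite !ramp_ge1 ?subrr// ler_pdivlMr// mul1r; lra.
rewrite -RintegralB//.
- by apply: eq_Rintegral => t _; rewrite phi'E mulrBr.
- exact/continuous_param_integrable/within_continuousM.
- exact/continuous_param_integrable/within_continuousM.
Qed.

(** The differences of ramps converge pointwise to the indicator of ]x, y] and
are bounded by 1, so dominated convergence applies. *)
Lemma integral_ramp_cvg g x y (N : nat) : L2 g -> 0 < x -> x < y -> y < 2 * pi ->
  (\int[mu]_(t in param) (g t *
     (ramp ((t - x) / step R N n) - ramp ((t - y) / step R N n))))%R
    @[n --> \oo] --> prim g y - prim g x.
Proof.
move=> gL x0 xy y2; have gI := L2_integrable gL.
have x0' := ltW x0; have xy' := ltW xy; have y2' := ltW y2.
pose phi n t := ramp ((t - x) / step R N n) - ramp ((t - y) / step R N n).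
have gxyI : mu.-integrable `[x, y] (EFin \o g) by exact: integrable_param_itv.
have -> : prim g y - prim g x = (\int[mu]_(t in param) (g \_ `]x, y]) t)%R.
  rewrite primB// -Rintegral_mkcondr setIidr.
    rewrite Rintegral_itv_obnd_cbnd//.
    by apply: (integrableS _ _ _ gxyI) => //; exact: subset_itv_oc_cc.
  move=> t; rewrite /Defs.param /= !in_itv /= => /andP[xt ty].
  by rewrite (le_trans x0' (ltW xt)) (le_trans ty).
apply: fine_cvg.
have mphi n : measurable_fun param (phi n).
  apply: continuous_param_measurable; apply: continuous_subspaceT => t.
  have c z : {for t, continuous (fun t => ramp ((t - z) / step R N n))}.
    exact: is_derive_continuous (is_derive_bump _ _ _).
  by rewrite /phi; apply: cvgB; exact: c.
have [] := @dominated_convergence _ _ _ mu param (@measurable_param_ocitv R)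
  (fun n t => (g t * phi n t)%:E) (fun t => ((g \_ `]x, y]) t)%:E) (fun t => `|g t|%:E).
- move=> n; apply/measurable_EFinP; apply: measurable_funM; [by case: gL|exact: mphi].
- apply/measurable_EFinP.
  refine ((measurable_restrict g _ _).1 _) => //; first exact: measurable_param.
  have [mg _] := gL.
  by refine (measurable_funS _ _ mg); [exact: measurable_param|exact: subIsetl].
- apply: nearW => t _; apply: cvg_EFin; first by near=> n.
  rewrite /= /comp /=.
  have lim0 z : z < t -> \forall n \near \oo, ramp ((t - z) / step R N n) = 1.
    rewrite -subr_gt0 => zt.
    have /cvgrPdist_lt/(_ _ zt) := @cvg_step R N.
    apply: filterS => n; rewrite sub0r normrN gtr0_norm ?step_gt0// => h.
    by rewrite ramp_ge1// ler_pdivlMr ?step_gt0// mul1r ltW.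
  have lim1 z n : t <= z -> ramp ((t - z) / step R N n) = 0.
    by move=> tz; rewrite ramp_le0// ler_pdivrMr ?step_gt0// mul0r subr_le0.
  suff : \forall n \near \oo, g t * phi n t = (g \_ `]x, y]) t.
    move=> H; apply: cvg_near_cst; exact: H.
  rewrite patchE; case: ifPn => [|].
    rewrite inE /= in_itv /= => /andP[xt ty].
    by move: (lim0 _ xt); apply: filterS => n; rewrite /phi => ->; rewrite lim1// subr0 mulr1.
  rewrite notin_setE /= in_itv /= => /negP; rewrite negb_and -leNgt -ltNge.
  move=> /orP[tx|yt].
    by near=> n; rewrite /phi !lim1// ?subrr ?mulr0// (le_trans tx).
  move: (lim0 _ yt) (lim0 _ (lt_trans xy yt)); apply: filterS2 => n.
  by rewrite /phi => -> ->; rewrite subrr mulr0.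
- exact: integrable_norm.
- apply: nearW => t n _; rewrite /= lee_fin normrM ler_piMr//.
  have /andP[a0 a1] := ramp_itv ((t - x) / step R N n).
  have /andP[b0 b1] := ramp_itv ((t - y) / step R N n).
  by rewrite ler_norml /phi; apply/andP; split; lra.
move=> limI _; rewrite /Rintegral fineK//.
by apply: integrable_fin_num => //; exact: limI.
Unshelve. all: by end_near. Qed.

(** Testing the weak derivative against smoothed indicators of ]x, y] and
letting the smoothing tend to 0 leaves f x - f y on one side and minus the
integral of g over [x, y] on the other. *)
Lemma H1_abs_cont f : H1 f -> exists g, abs_cont f g.
Proof.
move=> [cf [g gL fg]]; exists g; split => //.
suff H x y : 0 < x -> x < y -> y < 2 * pi -> f y - f x = prim g y - prim g x.
  move=> x y /andP[x0 x2] /andP[y0 y2]; have [xy|yx|->] := ltgtP x y.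
  - exact: H.
  - by have := H _ _ y0 yx x2; lra.
  - by rewrite !subrr.
move=> x0 xy y2.
have [N hN] : exists N, forall n, step R N n < 2 * pi - y :> R.
  by apply: step_lt; rewrite subr_gt0.
have bcvg z : inner z ->
   (\int[mu]_(t in param) (f t * bump (step R N n) z t))%R @[n --> \oo] --> f z.
  move=> zi; apply/cvgrPdist_le => d d0.
  have [e0 e00 He0] := bump_approx cf zi d0.
  have /cvgrPdist_lt/(_ _ e00) := @cvg_step R N.
  apply: filterS => n; rewrite sub0r normrN gtr0_norm ?step_gt0// => h.
  by rewrite distrC; apply: He0 => //; exact: step_gt0.
have [xi yi] : inner x /\ inner y.
  by rewrite /inner x0 y2 (lt_trans x0 xy) (lt_trans xy y2).
have E n : - (\int[mu]_(t in param) (g t *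
     (ramp ((t - x) / step R N n) - ramp ((t - y) / step R N n))))%R =
   (\int[mu]_(t in param) (f t * bump (step R N n) x t))%R -
   (\int[mu]_(t in param) (f t * bump (step R N n) y t))%R.
  rewrite (weak_derivative_bump fg)//; first exact: step_gt0.
  by have := hN n; lra.
have h1 : - (\int[mu]_(t in param) (g t *
     (ramp ((t - x) / step R N n) - ramp ((t - y) / step R N n))))%R
     @[n --> \oo] --> f x - f y.
  by under eq_fun do rewrite E; apply: cvgB; exact: bcvg.
have h2 := cvgN (integral_ramp_cvg N gL x0 xy y2).
have E2 : f x - f y = - (prim g y - prim g x).
  by apply: (cvg_unique _ h1 (h2 _)); exact: Rhausdorff.
lra.
Qed.

End DuBoisReymond.

(** * Interpolation on an arc *)

Section Arc.
Variable R : realType.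
Implicit Types (f w D W F : R -> R) (x y z u v s t : R).
Notation mu := (@lebesgue_measure R).
Notation param := (@param R).
Hint Resolve measurable_param measurable_param_ocitv : core.

(** Cauchy's mean value theorem, in terms of the derivative f = F' / W' with
respect to W. *)
Lemma weighted_mvt F W f w x y : x <= y ->
  (forall z, x <= z <= y -> is_derive z (1 : R) F (f z * w z)) ->
  (forall z, x <= z <= y -> is_derive z (1 : R) W (w z)) ->
  (forall z, x <= z <= y -> 0 < w z) ->
  exists2 c, x <= c <= y & F y - F x = f c * (W y - W x).
Proof.
rewrite le_eqVlt => /predU1P[->|xy] dF dW w0.
  by exists y; rewrite ?lexx// !subrr mulr0.
pose H z := (W y - W x) *: F z - (F y - F x) *: W z.
pose H' z : R := (W y - W x) *: (f z * w z) - (F y - F x) *: w z.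
have dH z : x <= z <= y -> is_derive z (1 : R) H (H' z).
  by move=> xzy; apply: is_deriveB; apply: is_deriveZ; [exact: dF|exact: dW].
have [||c cxy] := @MVT R H H' x y xy.
- by move=> z /andP[/ltW xz /ltW zy]; apply: dH; rewrite xz.
- by apply: continuous_itv => z xzy; exact: is_derive_continuous (dH z xzy).
- rewrite in_itv /= in cxy; case/andP: cxy => xc cy.
  have xcy : x <= c <= y by rewrite !ltW.
  have -> : H y - H x = 0 by rewrite /H /GRing.scale /=; ring.
  move=> /eqP; rewrite eq_sym mulf_eq0 [y - x == 0]subr_eq0 [y == x]gt_eqF// orbF.
  rewrite /H' /GRing.scale /= mulrA -mulrBl mulf_eq0 [w c == 0]gt_eqF ?w0// orbF.
  by rewrite subr_eq0 => /eqP h; exists c; rewrite // mulrC h.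
Qed.

Lemma monotone_of_derive W w x y : x <= y ->
  (forall z, x <= z <= y -> is_derive z (1 : R) W (w z)) ->
  (forall z, x <= z <= y -> 0 < w z) -> W x <= W y.
Proof.
move=> xy dW w0.
have [||c xcy E] := @MVT_segment R W w x y xy.
- by move=> z /andP[/ltW xz /ltW zy]; apply: dW; rewrite xz.
- by apply: continuous_itv => z xzy; exact: is_derive_continuous (dW z xzy).
- by rewrite -subr_ge0 E mulr_ge0 ?subr_ge0// ltW// w0.
Qed.

(** Here W is the arclength, w the speed, D the arclength derivative of f, and P
a primitive of f^2 with respect to arclength.  In the first and in the last
third of the arc there are points u and u' with |f| <= rho.  Between them, at
distance at least l / 3, some D v is a difference quotient of f, so that
|D v| <= 6 rho / l.  As D oscillates by at most omega, this bounds D, and then f,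
on the whole arc. *)
Lemma arc_bound f D w W (P : R -> R) (a b l kappa rho omega : R) :
  a <= b -> 0 < l -> 0 <= rho -> 3 * kappa = rho ^+ 2 * l ->
  (forall z, a <= z <= b -> is_derive z (1 : R) f (D z * w z)) ->
  (forall z, a <= z <= b -> is_derive z (1 : R) W (w z)) ->
  (forall z, a <= z <= b -> is_derive z (1 : R) P (f z ^+ 2 * w z)) ->
  (forall z, a <= z <= b -> 0 < w z) ->
  W b - W a = l -> P b - P a <= kappa ->
  (forall u v, a <= u -> u <= v -> v <= b -> `|D v - D u| <= omega) ->
  forall z, a <= z <= b -> `|f z| <= 7 * rho + l * omega.
Proof.
move=> ab l0 rho0 kr df dW dP w0 Wl Pk osc z azb.
have sub u v s : a <= u -> v <= b -> u <= s <= v -> a <= s <= b.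
  by move=> au vb /andP[us sv]; rewrite (le_trans au us) (le_trans sv vb).
have cW u v : a <= u -> v <= b -> {within `[u, v], continuous W}.
  move=> au vb; apply: continuous_itv => s usv.
  exact: is_derive_continuous (dW s (sub _ _ _ au vb usv)).
have monW u v : a <= u -> u <= v -> v <= b -> W u <= W v.
  move=> au uv vb; apply: (@monotone_of_derive W w) => // s usv.
    exact/dW/(sub u v).
  exact/w0/(sub u v).
have mP u v : a <= u -> u <= v -> v <= b ->
    exists2 c, u <= c <= v & P v - P u = f c ^+ 2 * (W v - W u).
  move=> au uv vb; apply: (@weighted_mvt P W (fun s => f s ^+ 2) w) => // s usv.
  - exact/dP/(sub u v).
  - exact/dW/(sub u v).
  - exact/w0/(sub u v).
have mf u v : a <= u -> u <= v -> v <= b ->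
    exists2 c, u <= c <= v & f v - f u = D c * (W v - W u).
  move=> au uv vb; apply: (@weighted_mvt f W D w) => // s usv.
  - exact/df/(sub u v).
  - exact/dW/(sub u v).
  - exact/w0/(sub u v).
have monP u v : a <= u -> u <= v -> v <= b -> P u <= P v.
  move=> au uv vb; have [c _ E] := mP u v au uv vb.
  by rewrite -subr_ge0 E mulr_ge0 ?sqr_ge0// subr_ge0 monW.
have small u v : a <= u -> u <= v -> v <= b -> W v - W u = l / 3 ->
    exists2 c, u <= c <= v & `|f c| <= rho.
  move=> au uv vb Wuv; have [c ucv E] := mP u v au uv vb; exists c => //.
  have Puv : P v - P u <= kappa.
    by have := monP a u (lexx _) au (le_trans uv vb);
       have := monP v b (le_trans au uv) vb (lexx _); lra.
  rewrite -(@ler_pXn2r _ 2)// ?nnegrE// real_normK ?num_real//.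
  have : f c ^+ 2 * l <= rho ^+ 2 * l by rewrite -kr; move: Puv; rewrite E Wuv; lra.
  by rewrite ler_pM2r.
have [p pab Wp] : exists2 p, a <= p <= b & W p = W a + l / 3.
  have [|p] := @IVT _ W a b (W a + l / 3) ab (cW _ _ (lexx _) (lexx _)).
    have -> : W b = W a + l by lra.
    rewrite min_l ?max_r; lra.
  by rewrite in_itv /=; exists p.
have /andP[ap pb] := pab.
have [q qpb Wq] : exists2 q, p <= q <= b & W q = W a + 2 * (l / 3).
  have [|q] := @IVT _ W p b (W a + 2 * (l / 3)) pb (cW _ _ ap (lexx _)).
    have -> : W b = W a + l by lra.
    rewrite Wp min_l ?max_r; lra.
  by rewrite in_itv /=; exists q.
have /andP[pq qb] := qpb.
have [|u /andP[au up] fu] := small a p (lexx _) ap pb; first by lra.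
have [|u' /andP[qu' u'b] fu'] := small q b (le_trans ap pq) qb (lexx _); first by lra.
have uu' : u <= u' by rewrite (le_trans up)// (le_trans pq).
have [v /andP[uv vu'] fv] := mf u u' au uu' u'b.
have Wuu' : l / 3 <= W u' - W u.
  have := monW u p au up pb; have := monW q u' (le_trans ap pq) qu' u'b; lra.
have Dv : `|D v| * l <= 6 * rho.
  have : `|D v| * (l / 3) <= `|D v| * (W u' - W u) by rewrite ler_wpM2l.
  have -> : `|D v| * (W u' - W u) = `|f u' - f u|.
    by rewrite fv normrM [`|W u' - W u|]ger0_norm//; lra.
  have : `|f u' - f u| <= 2 * rho.
    by rewrite (le_trans (ler_normB _ _))//; lra.
  lra.
have Dall s : a <= s <= b -> `|D s| <= `|D v| + omega.
  move=> /andP[as_ sb].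
  have av : a <= v by exact: le_trans uv.
  have vb : v <= b by exact: le_trans u'b.
  have : `|D s - D v| <= omega.
    have [sv|/ltW vs] := leP s v; last exact: osc.
    by rewrite distrC; exact: osc.
  by move=> H; have := ler_normD (D v) (D s - D v); rewrite [D v + _]addrC subrK; lra.
have fin s t : a <= s -> s <= t -> t <= b -> `|f t - f s| <= 6 * rho + l * omega.
  move=> as_ st tb; have [c /andP[sc ct] ->] := mf s t as_ st tb.
  have Wst : 0 <= W t - W s <= l.
    have := monW a s (lexx _) as_ (le_trans st tb).
    have := monW t b (le_trans as_ st) tb (lexx _).
    by have := monW s t as_ st tb; move=> ? ? ?; apply/andP; split; lra.
  case/andP: Wst => Wst0 Wstl.
  rewrite normrM [`|W t - W s|]ger0_norm//.
  apply: (@le_trans _ _ ((`|D v| + omega) * l)); last by lra.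
  apply: ler_pM => //; apply: Dall.
  by rewrite (le_trans as_ sc) (le_trans ct tb).
have : `|f z - f u| <= 6 * rho + l * omega.
  case/andP: azb => az zb.
  have [zu|/ltW uz] := leP z u.
    by rewrite distrC; apply: fin => //; rewrite (le_trans up).
  exact: fin.
by move=> H; have := ler_normD (f u) (f z - f u); rewrite [f u + _]addrC subrK; lra.
Qed.

(** The same bound at both ends of an arc of length at least l: arc_bound is
applied to the two subarcs of length exactly l at the ends.  This avoids any
dependence on the total length. *)
Lemma endpoint_bound f D w W (P : R -> R) (x y l kappa rho omega : R) :
  x <= y -> 0 < l -> 0 <= rho -> 3 * kappa = rho ^+ 2 * l ->
  (forall z, x <= z <= y -> is_derive z (1 : R) f (D z * w z)) ->
  (forall z, x <= z <= y -> is_derive z (1 : R) W (w z)) ->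
  (forall z, x <= z <= y -> is_derive z (1 : R) P (f z ^+ 2 * w z)) ->
  (forall z, x <= z <= y -> 0 < w z) ->
  l <= W y - W x -> P y - P x <= kappa ->
  (forall u v, x <= u -> u <= v -> v <= y -> W v - W u <= l ->
     `|D v - D u| <= omega) ->
  `|f x| <= 7 * rho + l * omega /\ `|f y| <= 7 * rho + l * omega.
Proof.
move=> xy l0 rho0 kr df dW dP w0 Wl Pk osc.
have sub u v s : x <= u -> v <= y -> u <= s <= v -> x <= s <= y.
  by move=> au vb /andP[us sv]; rewrite (le_trans au us) (le_trans sv vb).
have cW : {within `[x, y], continuous W}.
  by apply: continuous_itv => s xsy; exact: is_derive_continuous (dW s xsy).
have monW u v : x <= u -> u <= v -> v <= y -> W u <= W v.
  move=> au uv vb; apply: (@monotone_of_derive W w) => // s usv.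
    exact/dW/(sub u v).
  exact/w0/(sub u v).
have monP u v : x <= u -> u <= v -> v <= y -> P u <= P v.
  move=> au uv vb.
  have [|||c _ E] := @weighted_mvt P W (fun s => f s ^+ 2) w u v uv.
  - by move=> s usv; exact/dP/(sub u v).
  - by move=> s usv; exact/dW/(sub u v).
  - by move=> s usv; exact/w0/(sub u v).
  by rewrite -subr_ge0 E mulr_ge0 ?sqr_ge0// subr_ge0 monW.
have arc a b : x <= a -> a <= b -> b <= y -> W b - W a = l ->
    forall z, a <= z <= b -> `|f z| <= 7 * rho + l * omega.
  move=> xa ab yb Wab; apply: (@arc_bound f D w W P a b l kappa) => //.
  - by move=> s asb; exact/df/(sub a b).
  - by move=> s asb; exact/dW/(sub a b).
  - by move=> s asb; exact/dP/(sub a b).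
  - by move=> s asb; exact/w0/(sub a b).
  - have := monP x a (lexx _) xa (le_trans ab yb).
    by have := monP b y (le_trans xa ab) yb (lexx _); lra.
  - move=> u v au uv vb; apply: osc => //; try exact: le_trans vb yb.
      exact: le_trans xa au.
    have := monW a u xa au (le_trans uv (le_trans vb yb)).
    by have := monW v b (le_trans xa (le_trans au uv)) vb yb; lra.
split.
- have [|p] := @IVT _ W x y (W x + l) xy cW.
    rewrite min_l ?max_r; lra.
  rewrite in_itv /= => /andP[xp py] Wp.
  by apply: (arc x p) => //; [lra|rewrite lexx].
- have [|p] := @IVT _ W x y (W y - l) xy cW.
    rewrite min_l ?max_r; lra.
  rewrite in_itv /= => /andP[xp py] Wp.
  by apply: (arc p y) => //; [lra|rewrite lexx andbT].
Qed.

End Arc.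

(** * Euclidean inner product *)

Section Dotp.
Variables (R : realType) (d : nat).
Implicit Types (a b : 'rV[R]_d).

Lemma dotp_ge0 a : 0 <= dotp a a.
Proof. by apply: sumr_ge0 => i _; rewrite -expr2 sqr_ge0. Qed.

Lemma sqr_coord_le_dotp a j : a ord0 j ^+ 2 <= dotp a a.
Proof.
rewrite /dotp (bigD1 j)//= -expr2 lerDl.
by apply: sumr_ge0 => i _; rewrite -expr2 sqr_ge0.
Qed.

Lemma coord_le_enorm a j : `|a ord0 j| <= enorm a.
Proof. by rewrite -sqrtr_sqr ler_wsqrtr// sqr_coord_le_dotp. Qed.

Lemma dotp_gt0 a : a != 0 -> 0 < dotp a a.
Proof.
move=> a0; rewrite lt_neqAle dotp_ge0 andbT eq_sym; apply: contra a0 => /eqP aa.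
apply/eqP/rowP => j; rewrite mxE; apply/eqP; rewrite -sqrf_eq0 eq_le sqr_ge0 andbT.
by rewrite -aa sqr_coord_le_dotp.
Qed.

Lemma enorm_gt0 a : a != 0 -> 0 < enorm a.
Proof. by move=> a0; rewrite sqrtr_gt0 dotp_gt0. Qed.

Lemma enorm_ge0 a : 0 <= enorm a.
Proof. exact: sqrtr_ge0. Qed.

Lemma dotpC a b : dotp a b = dotp b a.
Proof. by apply: eq_bigr => i _; rewrite mulrC. Qed.

Lemma dotpZl (k : R) a b : dotp (k *: a) b = k * dotp a b.
Proof. by rewrite /dotp mulr_sumr; apply: eq_bigr => i _; rewrite mxE mulrA. Qed.

Lemma dotpZr (k : R) a b : dotp a (k *: b) = k * dotp a b.
Proof. by rewrite dotpC dotpZl dotpC. Qed.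

Lemma dotpBl a b (e : 'rV[R]_d) : dotp (a - b) e = dotp a e - dotp b e.
Proof.
by rewrite /dotp -sumrB; apply: eq_bigr => i _; rewrite !mxE mulrBl.
Qed.

Lemma dotpBr a b (e : 'rV[R]_d) : dotp e (a - b) = dotp e a - dotp e b.
Proof. by rewrite dotpC dotpBl ![dotp _ e]dotpC. Qed.

Lemma unit_dotp a : a != 0 -> dotp ((enorm a)^-1 *: a) ((enorm a)^-1 *: a) = 1.
Proof.
move=> a0; have e0 := enorm_gt0 a0.
rewrite dotpZl dotpZr mulrA -[X in _ * X](sqr_sqrtr (dotp_ge0 a)) -/(enorm a).
by field; rewrite gt_eqF.
Qed.

(** Pythagoras: the squared norms of the tangential and normal parts add up to
that of a. *)
Lemma dotp_proj_le a v : dotp v v = 1 -> 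
  dotp (dotp a v *: v) (dotp a v *: v) <= dotp a a /\
  dotp (a - dotp a v *: v) (a - dotp a v *: v) <= dotp a a.
Proof.
move=> vv.
have E : dotp (a - dotp a v *: v) (a - dotp a v *: v) = dotp a a - dotp a v ^+ 2.
  rewrite dotpBl !dotpBr !dotpZl !dotpZr vv [dotp v a]dotpC; ring.
have E' : dotp (dotp a v *: v) (dotp a v *: v) = dotp a v ^+ 2.
  by rewrite dotpZl dotpZr vv; ring.
split; last by rewrite E gerBl sqr_ge0.
by rewrite E' -subr_ge0 -E dotp_ge0.
Qed.

End Dotp.

(** * Velocity, speed and D_s along a curve of class H^2 *)

Section Curves.
Variables (R : realType) (d : nat).
Notation mu := (@lebesgue_measure R).
Notation param := (@param R).
Hint Resolve measurable_param measurable_param_ocitv : core.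
Implicit Types (c h : R -> 'rV[R]_d).

Lemma derivable_on_continuous (A : set R) (f : R -> R) :
  (forall x, A x -> derivable_on A f x) -> {within A, continuous f}.
Proof.
move=> df; apply/subspace_continuousP => x Ax.
have /cvg_ex[l fl] := df x Ax.
apply/cvgrPdist_lt => e e0.
pose K := `|l| + 1.
have K0 : 0 < K by rewrite ltr_wpDl.
have eK : 0 < e / K by rewrite divr_gt0.
have H1 : \forall y \near x, y != x -> A y -> `|l - diff_quot f x y| < 1.
  by have /cvgrPdist_lt/(_ 1 ltr01) := fl.
have H2 : \forall y \near x, `|y - x| < e / K.
  by apply/nbhs_ballP; exists (e / K) => // y; rewrite /ball /= distrC.
apply: filterS2 H1 H2 => y h1 h2 Ay.
have [->|yx] := eqVneq y x; first by rewrite subrr normr0.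
have -> : f x - f y = - (diff_quot f x y * (y - x)).
  by rewrite /diff_quot divfK ?subr_eq0// opprB.
rewrite normrN normrM.
have qK : `|diff_quot f x y| <= K.
  have := ler_normB l (l - diff_quot f x y); rewrite opprB addrC subrK => H.
  by rewrite (le_trans H)// /K lerD2l ltW// h1.
rewrite (le_lt_trans (ler_wpM2r _ qK))//.
by rewrite mulrC -ltr_pdivlMr.
Qed.

Lemma Dtheta_coord c x j : Dtheta c x ord0 j = deriv_on param (fun y => c y ord0 j) x.
Proof. by rewrite mxE. Qed.

Lemma H2curve_is_derive c x j : H2curve c -> inner x ->
  is_derive x (1 : R) (fun y => c y ord0 j) (Dtheta c x ord0 j).
Proof.
move=> /(_ j)[dc _] xi; rewrite Dtheta_coord; apply: deriv_onP.
  exact: nbhs_param.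
exact/dc/inner_param.
Qed.

Lemma H2curve_continuous c j : H2curve c ->
  {within param, continuous (fun x => c x ord0 j)}.
Proof. by move=> /(_ j)[dc _]; exact: derivable_on_continuous. Qed.

Lemma H2curve_Dtheta c : H2curve c ->
  exists g : 'I_d -> R -> R, forall j, abs_cont (fun x => Dtheta c x ord0 j) (g j).
Proof.
move=> Hc.
have : forall j, exists g, abs_cont (fun x => Dtheta c x ord0 j) g.
  move=> j; have [_ /H1_abs_cont[g Hg]] := Hc j.
  by exists g; under eq_fun do rewrite Dtheta_coord.
by move=> /choice[g Hg]; exists g.
Qed.

Lemma H2curve_Dtheta_continuous c j : H2curve c ->
  {within param, continuous (fun x => Dtheta c x ord0 j)}.
Proof. by move=> /H2curve_Dtheta[g /(_ j)[]]. Qed.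

Lemma speed_gt0 c x : immersions c -> param x -> 0 < enorm (Dtheta c x).
Proof. by move=> [_ ci] xp; apply/enorm_gt0/ci. Qed.

Lemma inv_speed_abs_cont c : immersions c ->
  exists g, abs_cont (fun x => (enorm (Dtheta c x))^-1) g.
Proof.
move=> cI; have [Hc c0] := cI; have [g Hg] := H2curve_Dtheta Hc.
have := abs_cont_sum (index_enum 'I_d) (fun j => abs_contM (Hg j) (Hg j)).
move=> /abs_cont_invsqrt; apply => x xp.
exact/dotp_gt0/c0.
Qed.

Lemma inv_speed_continuous c : immersions c ->
  {within param, continuous (fun x => (enorm (Dtheta c x))^-1)}.
Proof. by move=> /inv_speed_abs_cont[g []]. Qed.

Lemma within_continuous_sqrt (u : R -> R) : {within param, continuous u} ->
  {within param, continuous (fun x => Num.sqrt (u x))}.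
Proof.
by move=> cu x; apply: continuous_comp; [exact: cu|exact: sqrt_continuous].
Qed.

Lemma speed_continuous c : H2curve c ->
  {within param, continuous (fun x => enorm (Dtheta c x))}.
Proof.
move=> Hc; apply: (within_continuous_sqrt (u := fun x => dotp (Dtheta c x) (Dtheta c x))).
apply: within_continuous_sum => j; apply: within_continuousM;
  exact: H2curve_Dtheta_continuous.
Qed.

Lemma Ds_coord c h x j :
  Ds c h x ord0 j = (enorm (Dtheta c x))^-1 * Dtheta h x ord0 j.
Proof. by rewrite mxE. Qed.

(** D_s h is the product of the absolutely continuous functions h' and 1 / |c'|,
the latter being the inverse square root of a sum of squares. *)
Lemma Ds_abs_cont c h : immersions c -> H2curve h ->
  exists E : 'I_d -> R -> R, forall j, abs_cont (fun x => Ds c h x ord0 j) (E j).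
Proof.
move=> /inv_speed_abs_cont[q Hq] /H2curve_Dtheta[g Hg].
exists (fun j x => (enorm (Dtheta c x))^-1 * g j x + Dtheta h x ord0 j * q x).
by move=> j; under eq_fun do rewrite Ds_coord; exact: abs_contM.
Qed.

End Curves.

(** * Upper and lower bounds of the metric *)

Section MetricBound.
Variables (R : realType) (d : nat).
Notation mu := (@lebesgue_measure R).
Notation param := (@param R).
Hint Resolve measurable_param measurable_param_ocitv : core.
Implicit Types (c h : R -> 'rV[R]_d).

Lemma integrable_contM (u g : R -> R) : {within param, continuous u} ->
  mu.-integrable param (EFin \o g) ->
  mu.-integrable param (EFin \o (fun x => u x * g x)).
Proof.
move=> cu gI; have [K K0 uK] := continuous_param_bounded cu.
have /integrableP[/measurable_EFinP mg _] := gI.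
apply: le_integrable (integrableZR K (integrable_norm gI)) => //.
  apply/measurable_EFinP/measurable_funM => //.
  exact: continuous_param_measurable.
move=> x xp /=; rewrite lee_fin !normrM normr_id ler_wpM2r// (le_trans (uK x xp))//.
exact: ler_norm.
Qed.

Lemma integrable_sumR (I : Type) (r : seq I) (F : I -> R -> R) :
  (forall i, mu.-integrable param (EFin \o F i)) ->
  mu.-integrable param (EFin \o (fun x => \sum_(i <- r) F i x)).
Proof.
move=> FI; elim: r => [|i r IH].
  under eq_fun do rewrite big_nil; exact: integrable_cst_param.
by under eq_fun do rewrite big_cons; apply: integrableDR.
Qed.

Variables (a0 a1 b1 a2 : R).

(** The metric at h = k is the integral of this function by definition. *)
Definition G1_density c h x : R :=
  (a0 * dotp (h x) (h x)
      + a1 * dotp (Ds_tan c h x) (Ds_tan c h x)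
      + b1 * dotp (Ds_nor c h x) (Ds_nor c h x)
      + a2 * dotp (Ds c (Ds c h) x) (Ds c (Ds c h) x))
     * enorm (Dtheta c x).

Hypotheses (a00 : 0 < a0) (a10 : 0 <= a1) (b10 : 0 <= b1) (a20 : 0 < a2).

Lemma G1_density_ge0 c h x : 0 <= G1_density c h x.
Proof.
rewrite mulr_ge0 ?enorm_ge0// !addr_ge0// mulr_ge0 ?dotp_ge0//; exact: ltW.
Qed.

(** Almost everywhere the pointwise second derivative is the integrable
derivative E of D_s h. *)
Lemma Ds_Ds_ae c h (E : 'I_d -> R -> R) :
  (forall j, abs_cont (fun x => Ds c h x ord0 j) (E j)) ->
  {ae mu, forall x, inner x -> forall j,
     Ds c (Ds c h) x ord0 j = (enorm (Dtheta c x))^-1 * E j x}.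
Proof.
move=> HE.
have H : {ae mu, forall x, forall j, inner x ->
    is_derive x (1 : R) (fun x => Ds c h x ord0 j) (E j x)}.
  apply: filter_forall => j; exact: abs_cont_ae (HE j).
move: H; apply: filterS; first exact: (ae_filter_ringOfSetsType mu).
move=> x Hx xi j; rewrite Ds_coord Dtheta_coord; congr (_ * _).
by apply: is_derive_deriv_on (Hx j xi); exact: nbhs_param.
Qed.

Lemma G1_density_le c h x (e : 'I_d -> R) : immersions c -> param x ->
  (forall j, Ds c (Ds c h) x ord0 j = (enorm (Dtheta c x))^-1 * e j) ->
  G1_density c h x <=
    (a0 * dotp (h x) (h x) + (a1 + b1) * dotp (Ds c h x) (Ds c h x)) *
      enorm (Dtheta c x) +
    a2 * \sum_(j < d) (enorm (Dtheta c x))^-1 * e j ^+ 2.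
Proof.
move=> cI xp eE; have w0 := speed_gt0 cI xp; have [_ c0] := cI.
have [t1 t2] := dotp_proj_le (Ds c h x) (unit_dotp (c0 _ xp)).
rewrite /G1_density [leLHS]mulrDl; apply: lerD.
  rewrite ler_wpM2r ?enorm_ge0// -addrA lerD2l mulrDl lerD// ler_wpM2l//.
rewrite -mulrA ler_wpM2l ?(ltW a20)// /dotp mulr_suml; apply: ler_sum => j _.
rewrite eE le_eqVlt; apply/orP; left; apply/eqP.
by field; rewrite gt_eqF.
Qed.

Lemma G1_density_ge c h x (e : 'I_d -> R) j : immersions c -> param x ->
  (forall j, Ds c (Ds c h) x ord0 j = (enorm (Dtheta c x))^-1 * e j) ->
  a0 * (h x ord0 j ^+ 2 * enorm (Dtheta c x)) <= G1_density c h x /\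
  a2 * ((enorm (Dtheta c x))^-1 * e j ^+ 2) <= G1_density c h x.
Proof.
move=> cI xp eE; have w0 := speed_gt0 cI xp.
have t0 := mulr_ge0 a10 (dotp_ge0 (Ds_tan c h x)).
have n0 := mulr_ge0 b10 (dotp_ge0 (Ds_nor c h x)).
have h0 := mulr_ge0 (ltW a00) (dotp_ge0 (h x)).
have D0 := mulr_ge0 (ltW a20) (dotp_ge0 (Ds c (Ds c h) x)).
split.
  rewrite mulrA ler_wpM2r ?enorm_ge0//.
  have : a0 * h x ord0 j ^+ 2 <= a0 * dotp (h x) (h x).
    by rewrite ler_wpM2l ?(ltW a00)// sqr_coord_le_dotp.
  lra.
have -> : a2 * ((enorm (Dtheta c x))^-1 * e j ^+ 2) =
    (a2 * (Ds c (Ds c h) x ord0 j ^+ 2)) * enorm (Dtheta c x).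
  by rewrite eE; field; rewrite gt_eqF.
rewrite ler_wpM2r ?enorm_ge0//.
have : a2 * Ds c (Ds c h) x ord0 j ^+ 2 <= a2 * dotp (Ds c (Ds c h) x) (Ds c (Ds c h) x).
  by rewrite ler_wpM2l ?(ltW a20)// sqr_coord_le_dotp.
lra.
Qed.

(** Finiteness of the integral is essential: the real-valued integral defining
the metric would be 0 otherwise. *)
Lemma prim_le_G1 c h (r : R -> R) x y :
  (\int[mu]_(x in param) (G1_density c h x)%:E < +oo)%E ->
  mu.-integrable param (EFin \o r) ->
  {ae mu, forall x, inner x -> 0 <= r x <= G1_density c h x} ->
  (forall x, inner x -> 0 <= r x) ->
  0 < x -> x < y -> y < 2 * pi ->
  prim r y - prim r x <= G1 a0 a1 b1 a2 c h h.
Proof.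
move=> Gfin rI rG r0 x0 xy y2.
have x0' := ltW x0; have xy' := ltW xy; have y2' := ltW y2.
have xyI : mu.-integrable `[x, y] (EFin \o r) by exact: integrable_param_itv.
have xyi z : `[x, y]%classic z -> inner z.
  by rewrite /= in_itv => /(inner_itv x0 y2).
rewrite primB// -lee_fin /G1 /Rintegral !fineK; first last.
- by apply: integrable_fin_num.
- by rewrite ge0_fin_numE//; apply: integral_ge0 => z _; rewrite lee_fin G1_density_ge0.
apply: ge0_ae_le_integral_subset.
- by move=> z /xyi zi; rewrite lee_fin r0.
- by move=> z _; rewrite lee_fin G1_density_ge0.
- by move=> z /xyi; exact: inner_param.
- move: rG; apply: filterS; first exact: (ae_filter_ringOfSetsType mu).
  by move=> z rG /xyi/rG/andP[_]; rewrite lee_fin.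
Qed.

(** The a0 and a2 terms of the metric, separately, on every subinterval. *)
Lemma G1_controls c h : immersions c -> H2curve h ->
  exists E : 'I_d -> R -> R, 
   [/\ forall j, abs_cont (fun x => Ds c h x ord0 j) (E j),
   forall j x y, 0 < x -> x < y -> y < 2 * pi ->
    let r z := h z ord0 j ^+ 2 * enorm (Dtheta c z) in
    a0 * (prim r y - prim r x) <= G1 a0 a1 b1 a2 c h h &
   forall j x y, 0 < x -> x < y -> y < 2 * pi ->
    let r z := (enorm (Dtheta c z))^-1 * E j z ^+ 2 in
    mu.-integrable param (EFin \o r) /\
    a2 * (prim r y - prim r x) <= G1 a0 a1 b1 a2 c h h].
Proof.
move=> cI Hh; have [Hc _] := cI.
have [E HE] := Ds_abs_cont cI Hh; exists E.
have ae1 := Ds_Ds_ae HE.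
have cw := speed_continuous Hc; have ciw := inv_speed_continuous cI.
have ch j : {within param, continuous (fun x => h x ord0 j)} by exact: H2curve_continuous.
have cD j : {within param, continuous (fun x => Ds c h x ord0 j)} by have [] := HE j.
have I1 j : mu.-integrable param (EFin \o (fun z => (enorm (Dtheta c z))^-1 * E j z ^+ 2)).
  apply: integrable_contM => //; apply: L2_sq_integrable.
  by have [] := HE j.
have cdot (f : R -> 'rV[R]_d) : 
    (forall j, {within param, continuous (fun x => f x ord0 j)}) ->
    {within param, continuous (fun x => dotp (f x) (f x))}.
  by move=> cf; apply: within_continuous_sum => j; exact: within_continuousM.
have I2 : mu.-integrable param (EFin \o (fun x =>
   (a0 * dotp (h x) (h x) + (a1 + b1) * dotp (Ds c h x) (Ds c h x)) *
      enorm (Dtheta c x))).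
  apply: continuous_param_integrable; apply: within_continuousM => //.
  apply: within_continuousD; (apply: within_continuousM; last exact: cdot);
    exact: continuous_cst_param.
have Gfin : (\int[mu]_(x in param) (G1_density c h x)%:E < +oo)%E.
  have IU := integrableDR I2 (integrableZR a2 (integrable_sumR (index_enum 'I_d) I1)).
  have /integrableP[_] := IU; apply: le_lt_trans.
  apply: ge0_ae_le_integral_subset => //.
    by move=> z _; rewrite lee_fin G1_density_ge0.
  move: ae1 (ae_inner R); apply: filterS2; first exact: (ae_filter_ringOfSetsType mu).
  move=> z Hz zi zp; rewrite /= lee_fin (le_trans _ (ler_norm _))//.
  by apply: G1_density_le => //; apply: Hz; exact: zi.
split => // j x y x0 xy y2 /=; last split => //.
- have x0' := ltW x0; have xy' := ltW xy; have y2' := ltW y2.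
  rewrite -primZB//; last first.
    apply: continuous_param_integrable; apply: within_continuousM => //.
    by rewrite /=; under eq_fun do rewrite expr2; apply: within_continuousM.
  have r0 z : 0 <= a0 * (h z ord0 j ^+ 2 * enorm (Dtheta c z)).
    by apply: mulr_ge0; [exact: ltW|apply: mulr_ge0; [exact: sqr_ge0|exact: enorm_ge0]].
  apply: prim_le_G1 => //.
  + apply: integrableZR.
    apply: continuous_param_integrable; apply: within_continuousM => //.
    by rewrite /=; under eq_fun do rewrite expr2; apply: within_continuousM.
  + move: ae1; apply: filterS; first exact: (ae_filter_ringOfSetsType mu).
    move=> z Hz zi; rewrite r0/=.
    exact: (G1_density_ge j cI (inner_param zi) (Hz zi)).1.
- have x0' := ltW x0; have xy' := ltW xy; have y2' := ltW y2.
  rewrite -primZB//.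
  have r0 z : 0 <= a2 * ((enorm (Dtheta c z))^-1 * E j z ^+ 2).
    by apply: mulr_ge0; [exact: ltW|apply: mulr_ge0; [rewrite invr_ge0 enorm_ge0|exact: sqr_ge0]].
  apply: prim_le_G1 => //.
  + exact: integrableZR.
  + move: ae1; apply: filterS; first exact: (ae_filter_ringOfSetsType mu).
    move=> z Hz zi; rewrite r0//=.
    exact: (G1_density_ge j cI (inner_param zi) (Hz zi)).2.
Qed.

End MetricBound.

(** * The metric controls increments along arcs that are not short *)

Section IncrementBound.
Variables (R : realType) (d : nat).
Notation mu := (@lebesgue_measure R).
Notation param := (@param R).
Hint Resolve measurable_param measurable_param_ocitv : core.
Implicit Types (c h : R -> 'rV[R]_d).
Variables (a0 a1 b1 a2 : R).
Hypotheses (a00 : 0 < a0) (a10 : 0 <= a1) (b10 : 0 <= b1) (a20 : 0 < a2).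

(** The coordinates of the unit tangent are at most 1. *)
Lemma chord_le_arclength c x y k : immersions c -> 0 < x -> x < y -> y < 2 * pi ->
  `|c y ord0 k - c x ord0 k| <=
    prim (fun z => enorm (Dtheta c z)) y - prim (fun z => enorm (Dtheta c z)) x.
Proof.
move=> cI x0 xy y2; have [Hc _] := cI.
have xyi z : x <= z <= y -> inner z by exact: inner_itv.
have w0 z : x <= z <= y -> 0 < enorm (Dtheta c z).
  by move=> /xyi/inner_param; exact: speed_gt0.
have dW z : x <= z <= y -> is_derive z (1 : R) (prim (fun z => enorm (Dtheta c z)))
    (enorm (Dtheta c z)).
  by move=> /xyi zi; apply: is_derive_prim => //; exact: speed_continuous.
have [z xzy|z xzy ->] := @weighted_mvt R (fun z => c z ord0 k) _
    (fun z => Dtheta c z ord0 k / enorm (Dtheta c z)) _ x y (ltW xy) _ dW w0.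
  rewrite divfK; last by rewrite gt_eqF// w0.
  exact: H2curve_is_derive (xyi _ xzy).
have Wge := monotone_of_derive (ltW xy) dW w0.
rewrite normrM [X in _ * X]ger0_norm ?subr_ge0// ler_piMl ?subr_ge0//.
rewrite normrM normfV [X in _ / X]gtr0_norm ?w0// ler_pdivrMr ?w0// mul1r.
exact: coord_le_enorm.
Qed.

(** Twice the bound of endpoint_bound for rho and omega of unit size, that is
with G^1(h, h) = 1. *)
Definition increment_cst (l : R) : R :=
  2 * (7 * Num.sqrt (3 / (a0 * l)) + l * (l / 2 + (2 * a2)^-1)).

Lemma increment_cst_gt0 l : 0 < l -> 0 < increment_cst l.
Proof.
move=> l0; rewrite mulr_gt0// ltr_wpDl ?mulr_ge0 ?sqrtr_ge0//.
by rewrite mulr_gt0// addr_gt0 ?divr_gt0 ?invr_gt0 ?mulr_gt0.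
Qed.

(** For e^2 >= G^1(h, h), G1_controls bounds the integrals of |h|^2 and of
|D_s^2 h|^2 along the arc by e^2 / a0 and e^2 / a2.  The oscillation of D_s h
over an arc of length l is at most the integral of |D_s^2 h|, hence at most
e (l / 2 + 1 / (2 a2)) by |E| <= (e w + E^2 / (e w)) / 2.  This gives the
hypotheses of endpoint_bound; then e decreases to the square root of the
metric. *)
Lemma increment_bound c h x y k j l : immersions c -> H2curve h ->
  0 < x -> x < y -> y < 2 * pi -> 0 < l -> l <= `|c y ord0 k - c x ord0 k| ->
  `|h y ord0 j - h x ord0 j| <=
    increment_cst l * Num.sqrt (G1 a0 a1 b1 a2 c h h).
Proof.
move=> cI Hh x0 xy y2 l0 lc; have [Hc _] := cI.
have [E [HE GA GB]] := G1_controls a00 a10 b10 a20 cI Hh.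
set G := G1 a0 a1 b1 a2 c h h in GA GB *.
have C0 := increment_cst_gt0 l0.
have x0' := ltW x0; have xy' := ltW xy; have y2' := ltW y2.
have xyi z : x <= z <= y -> inner z by exact: inner_itv.
pose w z := enorm (Dtheta c z).
have cw : {within param, continuous w} by exact: speed_continuous.
have wI := continuous_param_integrable cw.
have w0 z : inner z -> 0 < w z by move=> /inner_param; exact: speed_gt0.
have ch : {within param, continuous (fun z => h z ord0 j ^+ 2 * w z)}.
  apply: within_continuousM => //; under eq_fun do rewrite expr2.
  by apply: within_continuousM; exact: H2curve_continuous.
have G0 : 0 <= G by apply: Rintegral_ge0 => z _; exact: G1_density_ge0.
suff H e : 0 < e -> G <= e ^+ 2 ->
    `|h y ord0 j - h x ord0 j| <= increment_cst l * e.
  apply/ler_addgt0Pr => e e0.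
  pose e' := Num.sqrt G + e / increment_cst l.
  have s0 := sqrtr_ge0 G; have ec : 0 < e / increment_cst l by rewrite divr_gt0.
  have -> : increment_cst l * Num.sqrt G + e = increment_cst l * e'.
    by rewrite /e'; field; rewrite gt_eqF.
  apply: H; first by rewrite ltr_wpDl.
  by rewrite -[leLHS](sqr_sqrtr G0) lerXn2r ?nnegrE ?addr_ge0// ?lerDl// ltW.
move=> e0 Ge.
(* rho solves 3 kappa = rho^2 l. *)
pose kappa := e ^+ 2 / a0.
pose rho := e * Num.sqrt (3 / (a0 * l)).
pose omega := e * (l / 2 + (2 * a2)^-1).
have [] := @endpoint_bound R (fun z => h z ord0 j) (fun z => Ds c h z ord0 j)
  w (prim w) (prim (fun z => h z ord0 j ^+ 2 * w z)) x y l kappa rho omega xy' l0.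
- by rewrite mulr_ge0 ?sqrtr_ge0// ltW.
- rewrite /rho exprMn sqr_sqrtr ?divr_ge0 ?mulr_ge0 ?(ltW a00) ?(ltW l0)//.
  by rewrite /kappa; field; rewrite !gt_eqF.
- move=> z /xyi zi; rewrite Ds_coord mulrAC mulVf ?gt_eqF ?(w0 z)// mul1r.
  exact: H2curve_is_derive.
- by move=> z /xyi zi; exact: is_derive_prim.
- by move=> z /xyi zi; exact: is_derive_prim.
- by move=> z /xyi; exact: w0.
- exact: le_trans lc (chord_le_arclength k cI x0 xy y2).
- have := GA j x y x0 xy y2; rewrite /= => GA'.
  by rewrite ler_pdivlMr// mulrC (le_trans GA').
- move=> u v xu uv vy Wuv.
  have u0 : 0 < u by exact: lt_le_trans xu.
  have v2 : v < 2 * pi by exact: le_lt_trans y2.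
  have u0' := ltW u0; have v2' := ltW v2.
  move: uv; rewrite le_eqVlt => /predU1P[->|uv].
    rewrite subrr normr0 /omega mulr_ge0 ?(ltW e0)// addr_ge0// ?divr_ge0 ?(ltW l0)//.
    by rewrite invr_ge0 mulr_ge0// ltW.
  have uv' := ltW uv.
  have [BI GB'] := GB j u v u0 uv v2.
  rewrite (le_trans (abs_cont_dom (HE j) u0 uv' v2))//.
  have EI : mu.-integrable param (EFin \o E j) by have [_ /L2_integrable] := HE j.
  pose r z := e / 2 * w z + (2 * e)^-1 * ((w z)^-1 * E j z ^+ 2).
  have := @le_prim R (fun z => `|E j z|) r u v (integrable_norm EI).
  rewrite (primDB (integrableZR _ wI) (integrableZR _ BI))// !primZB//.
  (* The pointwise inequality is 2 (e w) |E| <= (e w)^2 + E^2. *)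
  move=> H; apply: le_trans (H _ _ _ _ _) _ => //.
  + by apply: integrableDR; exact: integrableZR.
  + move=> z zi; rewrite /r; have wz := w0 _ zi.
    rewrite -(@ler_pM2r _ (2 * e * w z)) ?mulr_gt0//.
    have -> : (e / 2 * w z + (2 * e)^-1 * ((w z)^-1 * E j z ^+ 2)) * (2 * e * w z) =
       (e * w z) ^+ 2 + `|E j z| ^+ 2.
      by rewrite real_normK ?num_real//; field; rewrite !gt_eqF.
    by have := sqr_ge0 (e * w z - `|E j z|); lra.
  + rewrite /omega [leRHS]mulrDr.
    have -> : e * (l / 2) = e / 2 * l by field.
    apply: lerD; first by rewrite ler_wpM2l// divr_ge0// ltW.
    rewrite mulrC ler_pdivrMr ?mulr_gt0//.
    have -> : e * (2 * a2)^-1 * (2 * e) = e ^+ 2 / a2 by field; rewrite gt_eqF.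
    by rewrite ler_pdivlMr// mulrC (le_trans GB').
move=> hx hy; rewrite (le_trans (ler_normB _ _))//.
apply: le_trans (lerD hy hx) _; rewrite /increment_cst /rho /omega.
by rewrite le_eqVlt; apply/orP; left; apply/eqP; ring.
Qed.

End IncrementBound.

(** * Time derivatives of a smooth path at a fixed point *)

Section Paths.
Variables (R : realType) (d : nat).
Notation mu := (@lebesgue_measure R).
Notation param := (@param R).
Notation time := (@time R).
Hint Resolve measurable_param measurable_param_ocitv : core.
Implicit Types (c h : R -> 'rV[R]_d) (p : R -> R -> 'rV[R]_d).

Definition eval_cst (x : R) : R := (Num.sqrt (x / 2))^-1 + (x / 2 + 2^-1).

Lemma eval_cst_gt0 x : 0 < x -> 0 < eval_cst x.
Proof.
move=> x0; rewrite addr_gt0 ?invr_gt0 ?sqrtr_gt0 ?divr_gt0//.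
by rewrite addr_gt0 ?divr_gt0 ?invr_gt0.
Qed.

(** Some u in [x / 2, x] has f u ^ 2 at most the mean of T' = f^2 + f'^2; the
increment from u to x is bounded through |f'| <= eta + f'^2 / (2 eta), whose
primitive eta z + T z / (2 eta) grows faster than both f and - f. *)
Lemma sobolev_eval (f f' T : R -> R) (x eta : R) : 0 < x -> 0 < eta ->
  (forall z, x / 2 <= z <= x -> is_derive z (1 : R) f (f' z)) ->
  (forall z, x / 2 <= z <= x -> is_derive z (1 : R) T (f z ^+ 2 + f' z ^+ 2)) ->
  T x - T (x / 2) <= eta ^+ 2 ->
  `|f x| <= eval_cst x * eta.
Proof.
move=> x0 eta0 df dT Teta.
have x2 : x / 2 < x by lra.
have x20 : 0 < x / 2 by lra.
have [||u xux uE] := @MVT_segment R T (fun z => f z ^+ 2 + f' z ^+ 2) (x / 2) x (ltW x2).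
- by move=> z; rewrite in_itv /= => /andP[/ltW xz /ltW zx]; apply: dT; rewrite xz.
- by apply: continuous_itv => z xzy; exact: is_derive_continuous (dT z xzy).
rewrite in_itv /= in xux; have /andP[xu ux] := xux.
have fu : `|f u| <= (Num.sqrt (x / 2))^-1 * eta.
  have s0 : 0 < Num.sqrt (x / 2) by rewrite sqrtr_gt0.
  rewrite mulrC ler_pdivlMr//.
  rewrite -(@ler_pXn2r _ 2)// ?nnegrE ?mulr_ge0 ?(ltW s0) ?(ltW eta0)//.
  rewrite exprMn sqr_sqrtr ?(ltW x20)// real_normK ?num_real//.
  apply: le_trans Teta; rewrite uE.
  have -> : x - x / 2 = x / 2 by lra.
  by rewrite ler_wpM2r ?(ltW x20)// lerDl sqr_ge0.
have mono (s : R) : s ^+ 2 = 1 -> s * (f u - f x) <= (x / 2 + 2^-1) * eta.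
  move=> s1.
  pose H z := eta * z + (2 * eta)^-1 * T z + s * f z.
  pose H' z := eta + (2 * eta)^-1 * (f z ^+ 2 + f' z ^+ 2) + s * f' z.
  have dH z : u <= z <= x -> is_derive z (1 : R) H (H' z).
    move=> /andP[uz zx]; have xzx : x / 2 <= z <= x by rewrite zx (le_trans xu).
    have d1 := is_deriveZ eta (is_derive_id z (1 : R)).
    have -> : H' z = (eta *: (1 : R)) + (2 * eta)^-1 *: (f z ^+ 2 + f' z ^+ 2) + s *: f' z.
      by rewrite /H' /GRing.scale /= mulr1.
    exact: (is_deriveD (is_deriveD d1 (is_deriveZ _ (dT z xzx))) (is_deriveZ _ (df z xzx))).
  have H'0 z : u <= z <= x -> 0 < H' z.
    move=> _; rewrite /H' -(@pmulr_rgt0 _ (2 * eta)); last by rewrite mulr_gt0.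
    have -> : 2 * eta * (eta + (2 * eta)^-1 * (f z ^+ 2 + f' z ^+ 2) + s * f' z) =
       eta ^+ 2 + f z ^+ 2 + ((eta + s * f' z) ^+ 2 - (s ^+ 2 - 1) * f' z ^+ 2).
      by field; rewrite gt_eqF.
    rewrite s1 subrr mul0r subr0 ltr_pwDl ?sqr_ge0// ltr_pwDl ?sqr_ge0// exprn_gt0//.
  have := monotone_of_derive ux dH H'0; rewrite /H => Hux.
  have Tmon : T x - T u <= eta ^+ 2.
    suff : T (x / 2) <= T u by lra.
    have [||v _ vE] := @MVT_segment R T (fun z => f z ^+ 2 + f' z ^+ 2) (x / 2) u xu.
    - move=> z; rewrite in_itv /= => /andP[/ltW xz /ltW zx]; apply: dT.
      by rewrite xz (le_trans zx).
    - apply: continuous_itv => z /andP[xz zu]; apply: is_derive_continuous (dT z _).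
      by rewrite xz (le_trans zu).
    by rewrite -subr_ge0 vE mulr_ge0 ?subr_ge0 ?addr_ge0 ?sqr_ge0.
  have Tm : (2 * eta)^-1 * (T x - T u) <= 2^-1 * eta.
    rewrite mulrC ler_pdivrMr ?mulr_gt0//.
    by have -> : 2^-1 * eta * (2 * eta) = eta ^+ 2 by field.
  have : eta * (x - u) <= eta * (x / 2) by rewrite ler_pM2l//; lra.
  by move: Tm Hux; lra.
have fd : `|f x - f u| <= (x / 2 + 2^-1) * eta.
  have := mono 1 (expr1n _ 2).
  have /mono : (-1) ^+ 2 = 1 :> R by rewrite sqrrN expr1n.
  by rewrite ler_norml; lra.
have := ler_normD (f u) (f x - f u); rewrite [f u + _]addrC subrK /eval_cst; lra.
Qed.

(** Only the first two terms of the norm are used, on [x / 2, x]. *)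
Lemma H2sqnorm_eval h (f' : R -> R) j x eta : inner x -> 0 < eta ->
  {within param, continuous (fun z => h z ord0 j)} ->
  {within param, continuous f'} ->
  (forall z, inner z -> is_derive z (1 : R) (fun z => h z ord0 j) (f' z)) ->
  (H2sqnorm h <= (eta ^+ 2)%:E)%E ->
  `|h x ord0 j| <= eval_cst x * eta.
Proof.
move=> /andP[x0 x2] eta0 ch cf' dh hn.
have x20 : 0 < x / 2 by lra.
have x2x : x / 2 <= x by lra.
pose g z := h z ord0 j ^+ 2 + f' z ^+ 2.
have csq (u : R -> R) : {within param, continuous u} ->
    {within param, continuous (fun z => u z ^+ 2)}.
  by move=> cu; under eq_fun do rewrite expr2; exact: within_continuousM.
have cg : {within param, continuous g} by apply: within_continuousD; exact: csq.
have gI := continuous_param_integrable cg.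
apply: (@sobolev_eval (fun z => h z ord0 j) f' (prim g)) => //.
- by move=> z /(inner_itv x20 x2); exact: dh.
- by move=> z /(inner_itv x20 x2); exact: is_derive_prim.
- rewrite primB// ?(ltW x20) ?(ltW x2)// -lee_fin; apply: le_trans hn.
  rewrite /Rintegral fineK; last first.
    by apply: integrable_fin_num => //; apply: integrable_param_itv => //; exact: ltW.
  apply: ge0_ae_le_integral_subset.
  + by move=> z _; rewrite lee_fin addr_ge0 ?sqr_ge0.
  + by move=> z _; rewrite lee_fin !addr_ge0 ?sqr_ge0.
  + by move=> z; rewrite /= in_itv /= => /(inner_itv x20 x2)/inner_param.
  + apply: nearW => z; rewrite /= in_itv /= => /(inner_itv x20 x2) zi.
    have f'E : f' z = Dtheta h z ord0 j.
      by rewrite Dtheta_coord (is_derive_deriv_on (nbhs_param zi) (dh z zi)).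
    rewrite lee_fin /g f'E /enorm !sqr_sqrtr ?dotp_ge0//.
    have := sqr_coord_le_dotp (h z) j; have := sqr_coord_le_dotp (Dtheta h z) j.
    by have := dotp_ge0 (Dtheta (Dtheta h) z); lra.
Qed.

(** The difference quotient minus its limit is the value at x of a curve whose
H^2 norm tends to 0. *)
Lemma smooth_path_diff_quot p n t x j : smooth_path p -> time t -> inner x ->
  diff_quot (fun s => iter n (@Dt R d) p s x ord0 j) t @ within time t^' -->
    iter n.+1 (@Dt R d) p t x ord0 j.
Proof.
move=> sp tt xi.
have [Ht lim0] := sp n t tt.
have /fine_cvgP[fin cv] := lim0.
have C0 : 0 < eval_cst x by apply: eval_cst_gt0; case/andP: xi.
have HDt : H2curve (iter n.+1 (@Dt R d) p t) by have [] := sp n.+1 t tt.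
apply/cvgrPdist_le => e e0.
pose eta := e / eval_cst x.
have eta0 : 0 < eta by rewrite divr_gt0.
have /cvgrPdist_lt/(_ (eta ^+ 2)) := cv; rewrite exprn_gt0// => /(_ isT) near1.
have near2 : \forall s \near within time t^', s != t /\ time s.
  suff : \forall s \near t, s != t -> time s -> s != t /\ time s by [].
  by apply/nbhs_ballP; exists 1 => //= s _.
apply: filterS3 near1 fin near2 => s /=; rewrite sub0r normrN => h1 h2 [st ts].
have [Hs _] := sp n s ts.
set q := iter n (@Dt R d) p in Ht Hs h1 h2 *.
set k : R -> 'rV[R]_d := (fun _ => _) in h1 h2.
have kE z : k z ord0 j = (s - t)^-1 * (q s z ord0 j - q t z ord0 j) -
     iter n.+1 (@Dt R d) p t z ord0 j by rewrite /k !mxE.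
rewrite distrC (_ : _ - _ = k x ord0 j); last by rewrite kE /diff_quot mulrC.
have -> : e = eval_cst x * eta by rewrite /eta mulrC divfK// gt_eqF.
pose f' z := (s - t)^-1 * (Dtheta (q s) z ord0 j - Dtheta (q t) z ord0 j) -
   Dtheta (iter n.+1 (@Dt R d) p t) z ord0 j.
have cc (u v w : R -> R) : {within param, continuous u} ->
   {within param, continuous v} -> {within param, continuous w} ->
   {within param, continuous (fun z => (s - t)^-1 * (u z - v z) - w z)}.
  move=> cu cv' cw; apply: within_continuousD; last exact: within_continuousN.
  apply: within_continuousM; first exact: continuous_cst_param.
  by apply: within_continuousD => //; exact: within_continuousN.
apply: (@H2sqnorm_eval k f') => //.
- by under eq_fun do rewrite kE; apply: cc; exact: H2curve_continuous.
- by apply: cc; exact: H2curve_Dtheta_continuous.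
- move=> z zi; under eq_fun do rewrite kE.
  exact: (is_deriveB (is_deriveZ (s - t)^-1 (is_deriveB (H2curve_is_derive j Hs zi)
    (H2curve_is_derive j Ht zi))) (H2curve_is_derive j HDt zi)).
- rewrite -(fineK h2) lee_fin (le_trans (ler_norm _))// ltW//.
Qed.

Lemma smooth_path_derivable p n x j : smooth_path p -> inner x ->
  forall t, time t -> derivable_on time (fun s => iter n (@Dt R d) p s x ord0 j) t.
Proof.
move=> sp xi t tt; apply/cvg_ex; exists (iter n.+1 (@Dt R d) p t x ord0 j).
exact: smooth_path_diff_quot.
Qed.

End Paths.

(** * Lower bound for the length of a path *)

Section PathLength.
Variables (R : realType) (d : nat).
Notation mu := (@lebesgue_measure R).
Notation param := (@param R).
Notation time := (@time R).
Implicit Types (c h : R -> 'rV[R]_d) (p : R -> R -> 'rV[R]_d).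
Variables (a0 a1 b1 a2 : R).
Hypotheses (a00 : 0 < a0) (a10 : 0 <= a1) (b10 : 0 <= b1) (a20 : 0 < a2).

(** t0 is the supremum of the times at which f is at most b. *)
Lemma last_exit (f : R -> R) (b : R) : {within time, continuous f} ->
  f 0 <= b -> b < f 1 ->
  exists t0 : R, [/\ 0 <= t0, t0 < 1, f t0 <= b & forall t, t0 < t -> t <= 1 -> b < f t].
Proof.
move=> cf f0 f1.
pose A := [set t | time t /\ f t <= b].
have A0 : A 0 by split => //; rewrite /Defs.time /= in_itv /= lexx ler01.
have supA : has_sup A.
  split; first by exists 0.
  by exists 1 => t [+ _]; rewrite /Defs.time /= in_itv /= => /andP[].
have le_sup t : A t -> t <= sup A by move=> At; apply: sup_ubound => //; case: supA.
have sup0 : 0 <= sup A by exact: le_sup.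
have sup1 : sup A <= 1.
  by apply: ge_sup; [exists 0|move=> t [+ _]; rewrite /Defs.time /= in_itv /= => /andP[]].
have tsup : time (sup A) by rewrite /Defs.time /= in_itv /= sup0.
have fsup : f (sup A) <= b.
  rewrite leNgt; apply/negP => bf.
  have /subspace_continuousP/(_ _ tsup)/cvgrPdist_lt/(_ (f (sup A) - b)) := cf.
  rewrite subr_gt0 => /(_ bf)/nbhs_ballP[r r0 hr].
  have [t At tr] := sup_adherent r0 supA.
  have [tt ft] := At.
  have : `|f (sup A) - f t| < f (sup A) - b.
    apply: hr => //; rewrite /ball /= ger0_norm ?subr_ge0 ?le_sup//; lra.
  by move=> /(le_lt_trans (ler_norm _)); lra.
exists (sup A); split => //.
- rewrite lt_neqAle sup1 andbT; apply: contraTneq f1 => s1.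
  by rewrite -leNgt -s1.
- move=> t st t1; rewrite ltNge; apply/negP => ft.
  have : A t by split => //; rewrite /Defs.time /= in_itv /= (le_trans sup0 (ltW st)).
  by move=> /le_sup; lra.
Qed.

Lemma time_inner (t : R) : 0 < t -> t < 1 -> nbhs t time.
Proof.
move=> t0 t1; have : t \in `]0, 1[ by rewrite in_itv /= t0.
by move=> /near_in_itvoo; apply: filterS => s; rewrite in_itv /= => /andP[/ltW s0 /ltW s1];
  rewrite /Defs.time /= in_itv /= s0.
Qed.

(** The sign sigma makes the final chord coordinate positive.  After the last
time t0 at which this coordinate is at most delta / 2, its time derivative is at
most increment_cst (delta / 2) times the speed of the path, and it grows by at
least delta / 2. *)
Lemma path_length_ge p x y j (delta sigma : R) : smooth_path p ->
  (forall t, time t -> immersions (p t)) ->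
  0 < x -> x < y -> y < 2 * pi -> 0 < delta -> `|sigma| = 1 ->
  sigma * (p 0 y ord0 j - p 0 x ord0 j) <= delta / 2 ->
  sigma * (p 1 y ord0 j - p 1 x ord0 j) = delta ->
  ((delta / 2 / increment_cst a0 a2 (delta / 2))%:E <= path_length a0 a1 b1 a2 p)%E.
Proof.
move=> sp ip x0 xy y2 delta0 s1 phi0 phi1.
have xi : inner x by rewrite /inner x0 (lt_trans xy).
have yi : inner y by rewrite /inner y2 andbT (lt_trans x0).
pose phi t := sigma * (p t y ord0 j - p t x ord0 j).
pose psi t := sigma * (Dt p t y ord0 j - Dt p t x ord0 j).
have cc (u v : R -> R) : {within time, continuous u} -> {within time, continuous v} ->
   {within time, continuous (fun t => sigma * (u t - v t))}.
  move=> cu cv t; apply: cvgM; first exact: cvg_cst.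
  by apply: cvgB; [exact: cu|exact: cv].
have cp n z : inner z -> {within time, continuous (fun t => iter n (@Dt R d) p t z ord0 j)}.
  by move=> zi; apply: derivable_on_continuous; exact: smooth_path_derivable.
have cphi : {within time, continuous phi} by apply: cc; exact: (cp 0).
have cpsi : {within time, continuous psi} by apply: cc; exact: (cp 1).
have dphi (t : R) : 0 < t -> t < 1 -> is_derive t (1 : R) phi (psi t).
  move=> t0 t1; have tn := time_inner t0 t1.
  have tt : time t by exact: nbhs_singleton tn.
  have dz z : inner z -> is_derive t (1 : R) (fun t => p t z ord0 j) (Dt p t z ord0 j).
    move=> zi; apply/diff_quot_is_derive.
    by have := @smooth_path_diff_quot R d p 0 t z j sp tt zi; rewrite within_dnbhs.
  exact: (is_deriveZ sigma (is_deriveB (dz _ yi) (dz _ xi))).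
have d20 : 0 < delta / 2 by lra.
have [||t0 [t00 t01 ft0 ht]] := @last_exit phi (delta / 2) cphi.
- exact: phi0.
- by rewrite /phi phi1; lra.
set C := increment_cst a0 a2 (delta / 2).
have C0 : 0 < C by exact: increment_cst_gt0.
have sub : `[t0, 1] `<=` time.
  by apply: subset_itv; rewrite bnd_simp.
have psiE (t : R) : t0 < t -> t <= 1 ->
    `|C^-1 * psi t| <= Num.sqrt (G1 a0 a1 b1 a2 (p t) (Dt p t) (Dt p t)).
  move=> tt t1; have timet : time t.
    by rewrite /Defs.time /= in_itv /= t1 (le_trans t00 (ltW tt)).
  rewrite normrM ger0_norm ?invr_ge0 ?(ltW C0)// ler_pdivrMl// /psi normrM s1 mul1r.
  have HD : H2curve (Dt p t) by have [] := sp 1 t timet.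
  apply: (@increment_bound R d a0 a1 b1 a2 a00 a10 b10 a20 (p t) (Dt p t) x y j) => //.
    exact: ip.
  have := ht t tt t1; rewrite /phi => H.
  apply: le_trans (ltW H) _; apply: le_trans (ler_norm _) _.
  by rewrite normrM s1 mul1r.
have cC (u : R -> R) : {within time, continuous u} ->
    {within `[t0, 1], continuous (fun t => C^-1 * u t)}.
  move=> /(continuous_subspaceW sub) cu t.
  by apply: cvgM; [exact: cvg_cst|exact: cu].
have I1 : (\int[mu]_(t in `[t0, 1%R]) (C^-1 * psi t)%:E =
    (C^-1 * phi 1)%:E - (C^-1 * phi t0)%:E)%E.
  have dF t : t \in `]t0, 1[ -> is_derive t (1 : R) (fun t => C^-1 * phi t) (C^-1 * psi t).
    rewrite in_itv /= => /andP[tt t1].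
    exact: (is_deriveZ C^-1 (dphi t (le_lt_trans t00 tt) t1)).
  have [_ la lb] := (continuous_within_itvP _ t01).1 (cC _ cphi).
  apply: (@continuous_FTC2 R (fun t => C^-1 * psi t) (fun t => C^-1 * phi t)) => //.
  - exact: cC.
  - by split => // t /dF[].
  - by move=> t /dF[_ <-]; rewrite derive1E.
apply: (@le_trans _ _ (\int[mu]_(t in `[t0, 1%R]) `|C^-1 * psi t|%:E)%E).
  have mpsi : measurable_fun `[t0, 1] (EFin \o (fun t => C^-1 * psi t)).
    apply/measurable_EFinP; apply: subspace_continuous_measurable_fun => //.
    exact: cC.
  apply: le_trans (le_abse_integral mu (measurable_itv _) mpsi).
  rewrite [X in (_ <= `|X|)%E]I1 -EFinB abse_EFin lee_fin -mulrBr.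
  apply: le_trans (ler_norm _); rewrite mulrC ler_pM2l ?invr_gt0// /phi phi1.
  by move: ft0; rewrite /phi; lra.
apply: ge0_ae_le_integral_subset.
- by move=> t _; rewrite lee_fin.
- by move=> t _; rewrite lee_fin sqrtr_ge0.
- exact: sub.
- exists [set t0]; split => //; first exact: lebesgue_measure_set1.
  move=> t /= /not_implyP[]; rewrite in_itv /= => /andP[tt t1] H; apply/eqP.
  rewrite eq_le tt andbT leNgt; apply/negP => t0t; apply: H.
  by rewrite lee_fin psiE.
Qed.

End PathLength.

(** * Difference quotients on a compact interval *)

Section Segments.
Variable R : realType.
Implicit Types (f g : R -> R) (a b x : R).

(** A nondegenerate interval has no isolated point, so limits at its points are
unique, including one-sided ones at the ends. *)
Lemma segment_proper a b x : a < b -> `[a, b]%classic x ->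
  ProperFilter (within `[a, b] x^').
Proof.
move=> ab; rewrite /= in_itv /= => /andP[ax xb].
apply: Build_ProperFilter_ex => P /nbhs_ballP[e e0 xP].
pose r := Num.min (e / 2) ((b - a) / 2).
have r0 : 0 < r by rewrite lt_min !divr_gt0// subr_gt0.
have re : r <= e / 2 by rewrite ge_min lexx.
have rb : r <= (b - a) / 2 by rewrite ge_min lexx orbT.
have e0' : 0 < e by [].
have [xm|mx] := leP x ((a + b) / 2).
  exists (x + r); apply: xP.
  - by rewrite /ball /= opprD addrA subrr add0r normrN gtr0_norm//; lra.
  - by rewrite gt_eqF// ltrDl.
  - by rewrite /= in_itv /=; apply/andP; split; lra.
exists (x - r); apply: xP.
- by rewrite /ball /= opprB addrC subrK gtr0_norm//; lra.
- by rewrite lt_eqF// gtrBl.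
- by rewrite /= in_itv /=; apply/andP; split; lra.
Qed.

Lemma segment_diff_quot a b f g x l :
  `[a, b]%classic x -> (forall y, `[a, b]%classic y -> f y = g y) ->
  is_derive x (1 : R) g l -> diff_quot f x @ within `[a, b] x^' --> l.
Proof.
move=> xab fg /diff_quot_is_derive gl.
apply: cvg_trans (cvg_trans (cvg_app _ (@cvg_within _ x^' _ `[a, b]%classic)) gl).
apply: near_eq_cvg.
suff : \forall y \near x, y != x -> `[a, b]%classic y -> diff_quot g x y = diff_quot f x y by [].
by apply/nbhs_ballP; exists 1 => //= y _ _ yab; rewrite /diff_quot !fg.
Qed.

Lemma segment_deriv_on a b f g x l : a < b ->
  `[a, b]%classic x -> (forall y, `[a, b]%classic y -> f y = g y) ->
  is_derive x (1 : R) g l -> deriv_on `[a, b] f x = l.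
Proof.
move=> ab xab fg gl; apply: cvg_lim; first exact: Rhausdorff.
- exact: segment_proper.
- exact: segment_diff_quot xab fg gl.
Qed.

End Segments.

(** * Straight segments from the origin *)

Section Radial.
Variables (R : realType) (d : nat).
Notation mu := (@lebesgue_measure R).
Notation param := (@param R).
Notation time := (@time R).
Hint Resolve measurable_param measurable_param_ocitv : core.

Definition ray (r : R) : R -> 'rV[R]_d := fun x => const_mx (r * x).

Lemma is_derive_scale (r x : R) : is_derive x (1 : R) (fun y => r * y) r.
Proof.
have := is_deriveZ r (is_derive_id x (1 : R)).
by have -> : r *: (1 : R) = r by exact: mulr1.
Qed.

Lemma Dtheta_ray r x : param x -> Dtheta (ray r) x = const_mx r.
Proof.
move=> xp; apply/rowP => j; rewrite !mxE.
apply: (@segment_deriv_on _ 0 (2 * pi) _ (fun y => r * y)) => //.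
- exact: two_pi_gt0.
- by move=> y _; rewrite mxE.
- exact: is_derive_scale.
Qed.

Lemma Dtheta_const (f : R -> 'rV[R]_d) (v : 'rV[R]_d) x : param x ->
  (forall y, param y -> f y = v) -> Dtheta f x = 0.
Proof.
move=> xp fv; apply/rowP => j; rewrite !mxE.
apply: (@segment_deriv_on _ 0 (2 * pi) _ (cst (v ord0 j))) => //.
- exact: two_pi_gt0.
- by move=> y yp; rewrite fv.
Qed.

(** Test functions vanish at both end points, so the integral of phi' is 0. *)
Lemma H1_const (u : R -> R) (r : R) : (forall x, param x -> u x = r) -> H1 u.
Proof.
move=> ur; split.
  apply: (@subspace_eq_continuous _ _ _ (fun=> r) u); last exact: continuous_cst_param.
  by move=> x; rewrite inE => xp; rewrite ur.
exists (fun=> 0); first exact: L2_cst.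
move=> phi [dphi cphi [a [b [a0 b2 phi0]]]].
have -> : (\int[mu]_(x in param) (0 * phi x))%R = 0.
  under eq_Rintegral do rewrite mul0r.
  by rewrite Rintegral_cst// mul0r.
rewrite oppr0; transitivity (\int[mu]_(x in param) (r * derive1 phi x))%R.
  by apply: eq_Rintegral => x; rewrite inE => xp; rewrite ur.
have out x : ~~ (a <= x <= b) -> phi x = 0 by move=> xab; apply: phi0; rewrite in_itv.
rewrite /Rintegral.
have -> : (\int[mu]_(x in param) (r * derive1 phi x)%:E =
   (r * phi (2 * pi) - r * phi 0)%:E)%E.
  apply: (@ftc_itv _ (fun x => r * phi x) (fun x => r * derive1 phi x)).
  - exact: two_pi_gt0.
  - by apply: continuous_subspaceT => x; apply: cvgM; [exact: cvg_cst|exact: cphi].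
  - by move=> z _; have := is_deriveZ r (derivableP (dphi z)); rewrite derive1E.
rewrite /= !out ?mulr0 ?subrr//; first by rewrite leNgt a0.
by rewrite [_ <= b]leNgt b2 andbF.
Qed.

Lemma H2curve_ray r : H2curve (ray r).
Proof.
move=> j; split.
  move=> x xp; apply/cvg_ex; exists r.
  apply: (segment_diff_quot xp _ (is_derive_scale r x)) => y _.
  by rewrite mxE.
apply: (@H1_const _ r) => x xp; have := Dtheta_coord (ray r) x j.
by rewrite Dtheta_ray// mxE.
Qed.

Lemma dotp_const_mx (r s : R) : dotp (const_mx r : 'rV[R]_d) (const_mx s) = d%:R * (r * s).
Proof.
rewrite /dotp (eq_bigr (fun=> r * s)); last by move=> i _; rewrite !mxE.
by rewrite big_const_ord iter_addr_0 mulr_natl.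
Qed.

Lemma immersion_ray r : (0 < d)%N -> r != 0 -> immersions (ray r).
Proof.
move=> d0 r0; split; first exact: H2curve_ray.
move=> x xp; rewrite Dtheta_ray//; apply: contra r0 => /eqP/rowP/(_ (Ordinal d0)).
by rewrite !mxE => ->.
Qed.

Lemma le_integral_param (f : R -> R) (K : R) :
  (forall x, param x -> 0 <= f x <= K) ->
  (\int[mu]_(x in param) (f x)%:E <= (K * (2 * pi))%:E)%E.
Proof.
move=> fK.
apply: (@le_trans _ _ (\int[mu]_(x in param) K%:E)%E).
  apply: ge0_ae_le_integral_subset => //.
  - by move=> x /fK/andP[]; rewrite lee_fin.
  - by move=> x /fK/andP[f0 /(le_trans f0)]; rewrite lee_fin.
  - by apply: nearW => x /fK/andP[_]; rewrite lee_fin.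
rewrite integral_cst// [X in (_ * X)%E](_ : _ = (2 * pi)%:E) -?EFinM//.
by rewrite /Defs.param [LHS]lebesgue_measure_itv /= lte_fin two_pi_gt0 -EFinB subr0.
Qed.

Lemma H2sqnorm_ray r :
  (H2sqnorm (ray r) <= (r ^+ 2 * (d%:R * ((2 * pi) ^+ 2 + 1) * (2 * pi)))%:E)%E.
Proof.
rewrite (_ : r ^+ 2 * _ = r ^+ 2 * d%:R * ((2 * pi) ^+ 2 + 1) * (2 * pi)); last by ring.
apply: le_integral_param => x xp.
rewrite Dtheta_ray// (Dtheta_const (v := const_mx r) xp); last first.
  by move=> y yp; rewrite Dtheta_ray.
rewrite /enorm !sqr_sqrtr ?dotp_ge0// !dotp_const_mx.
have x2 : x ^+ 2 <= (2 * pi) ^+ 2.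
  move: xp; rewrite /Defs.param /= in_itv /= => /andP[x0 x2].
  by rewrite lerXn2r// nnegrE// ltW// two_pi_gt0.
have dr : 0 <= d%:R * r ^+ 2 :> R by rewrite mulr_ge0 ?ler0n ?sqr_ge0.
have -> : d%:R * (r * x * (r * x)) + d%:R * (r * r) + d%:R * (0 * 0) =
    (d%:R * r ^+ 2) * (x ^+ 2 + 1) by ring.
have -> : r ^+ 2 * d%:R * ((2 * pi) ^+ 2 + 1) =
    d%:R * r ^+ 2 * ((2 * pi) ^+ 2 + 1) by ring.
apply/andP; split; first by rewrite mulr_ge0// addr_ge0// sqr_ge0.
by rewrite ler_wpM2l// lerD2r.
Qed.

Section RayPath.
Variable Q : nat -> R -> R.
Hypothesis dQ : forall n t, is_derive t (1 : R) (Q n) (Q n.+1 t).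

(** All time derivatives of a path of rays are rays, so the whole jet of the path
reduces to a sequence Q of real functions, each the derivative of the previous
one. *)
Lemma iter_Dt_ray n t : time t -> iter n (@Dt R d) (fun t => ray (Q 0 t)) t = ray (Q n t).
Proof.
elim: n t => [//|n IH] t tt; rewrite iterS; apply/funext => x.
apply/rowP => j; rewrite !mxE.
apply: (@segment_deriv_on _ 0 1 _ (fun s => Q n s * x)) => //.
- by move=> s st; rewrite IH// mxE.
- have := is_deriveZ x (dQ n t).
  have -> : x \*: Q n = fun s => Q n s * x by apply/funext => s; rewrite mulrC.
  by have -> : x *: Q n.+1 t = Q n.+1 t * x by rewrite mulrC.
Qed.

Lemma smooth_path_ray : smooth_path (fun t => ray (Q 0 t)).
Proof.
move=> n t tt; rewrite iter_Dt_ray//; split; first exact: H2curve_ray.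
pose B : R := d%:R * ((2 * pi) ^+ 2 + 1) * (2 * pi).
pose k s := diff_quot (Q n) t s - Q n.+1 t.
have ndt : \forall s \near within time t^', time s.
  suff : \forall s \near t, s != t -> time s -> time s by [].
  by apply/nbhs_ballP; exists 1 => //= s _.
apply: (@squeeze_cvge _ _ _ _ (cst 0%E) _ (fun s => (k s ^+ 2 * B)%:E)).
- move: ndt; apply: filterS => s ts; apply/andP; split.
    by apply: integral_ge0 => x _; rewrite lee_fin !addr_ge0 ?sqr_ge0.
  rewrite (iter_Dt_ray n ts) (iter_Dt_ray n.+1 tt).
  have -> : (fun x => (s - t)^-1 *: (ray (Q n s) x - ray (Q n t) x) -
      ray (Q n.+1 t) x) = ray (k s).
    by apply/funext => x; apply/rowP => j; rewrite !mxE /k /diff_quot; ring.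
  exact: H2sqnorm_ray.
- exact: cvg_cst.
- apply: cvg_EFin; first by near=> s.
  have -> : 0 = 0 ^+ 2 * B by rewrite expr0n /= mul0r.
  apply: cvgM; last exact: cvg_cst.
  rewrite /comp /=; under eq_fun do rewrite expr2; rewrite expr2.
  have k0 : k s @[s --> within time t^'] --> 0.
    rewrite -(subrr (Q n.+1 t)); apply: cvgB; last exact: cvg_cst.
    exact: (@segment_diff_quot _ 0 1 _ (Q n)).
  exact: (cvgM k0 k0).
Unshelve. all: by end_near. Qed.

End RayPath.
End Radial.

(** * Segments shrinking to a point form a Cauchy sequence *)

Section Shrinking.
Variables (R : realType) (d : nat).
Notation mu := (@lebesgue_measure R).
Notation param := (@param R).
Notation time := (@time R).
Hint Resolve measurable_param measurable_param_ocitv : core.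
Variables (a0 a1 b1 a2 : R).
Hypotheses (a00 : 0 < a0) (a10 : 0 <= a1) (b10 : 0 <= b1) (a20 : 0 < a2).
Hypothesis d0 : (0 < d)%N.

(** An upper bound, for rho <= 1, of the metric of the shrinking path divided by
rho'^2. *)
Definition shrink_cst : R :=
  4 * Num.sqrt d%:R * (a0 * d%:R * (2 * pi) ^+ 2 + (a1 + b1)) * (2 * pi).

Lemma shrink_sum_ge0 : 0 <= a0 * d%:R * (2 * pi) ^+ 2 + (a1 + b1).
Proof.
apply: addr_ge0; last exact: addr_ge0.
by apply: mulr_ge0; [rewrite mulr_ge0 ?ler0n// ltW|exact: sqr_ge0].
Qed.

Lemma G1_ray (rho v : R) : 0 < rho -> rho <= 1 ->
  G1 a0 a1 b1 a2 (ray d (rho ^+ 2)) (ray d (2 * rho * v)) (ray d (2 * rho * v)) <=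
  v ^+ 2 * shrink_cst.
Proof.
move=> rho0 rho1.
set c := ray d (rho ^+ 2); set h := ray d (2 * rho * v).
have r20 : 0 < rho ^+ 2 by rewrite exprn_gt0.
have cI : immersions c by apply: immersion_ray => //; rewrite gt_eqF.
pose e := Num.sqrt (d%:R : R).
have dR : 0 < d%:R :> R by rewrite ltr0n.
have e0 : 0 < e by rewrite sqrtr_gt0.
have ee : e ^+ 2 = d%:R by rewrite sqr_sqrtr// ltW.
have wE x : param x -> enorm (Dtheta c x) = e * rho ^+ 2.
  move=> xp; rewrite Dtheta_ray// /enorm dotp_const_mx -expr2 sqrtrM ?ler0n//.
  by rewrite sqrtr_sqr ger0_norm// ltW.
have DsE x : param x -> Ds c h x = const_mx (2 * v / (e * rho)).
  move=> xp; rewrite /Ds wE// Dtheta_ray//; apply/rowP => j; rewrite !mxE.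
  by field; rewrite !gt_eqF.
have DDs x : param x -> forall j, Ds c (Ds c h) x ord0 j = (enorm (Dtheta c x))^-1 * 0.
  by move=> xp j; rewrite Ds_coord (Dtheta_const xp DsE) mxE.
pose K := v ^+ 2 * (4 * e * (a0 * d%:R * (2 * pi) ^+ 2 + (a1 + b1))).
have K0 : 0 <= K.
  apply: mulr_ge0; first exact: sqr_ge0.
  by apply: mulr_ge0; [rewrite mulr_ge0// ltW|exact: shrink_sum_ge0].
have qK x : param x -> 0 <= G1_density a0 a1 b1 a2 c h x <= K.
  move=> xp; rewrite G1_density_ge0//=.
  apply: le_trans (G1_density_le a0 a10 b10 a20 (e := fun=> 0) cI xp (DDs x xp)) _.
  rewrite big1 ?mulr0 ?addr0; last by move=> j _; rewrite expr0n mulr0.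
  rewrite wE// DsE// !dotp_const_mx.
  have x2 : x ^+ 2 <= (2 * pi) ^+ 2.
    move: xp; rewrite /Defs.param /= in_itv /= => /andP[x0 x2].
    by rewrite lerXn2r// nnegrE// ltW// two_pi_gt0.
  have -> : (a0 * (d%:R * (2 * rho * v * x * (2 * rho * v * x))) + (a1 + b1) *
     (d%:R * (2 * v / (e * rho) * (2 * v / (e * rho))))) * (e * rho ^+ 2) =
     v ^+ 2 * (4 * e * (a0 * d%:R * (x ^+ 2 * (rho ^+ 2 * rho ^+ 2)) + (a1 + b1))).
    by rewrite -ee; field; rewrite !gt_eqF.
  rewrite /K ler_wpM2l ?sqr_ge0// ler_wpM2l ?mulr_ge0 ?(ltW e0)// lerD2r.
  rewrite ler_wpM2l ?mulr_ge0 ?ler0n ?(ltW a00)//.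
  rewrite -[leRHS]mulr1 ler_pM ?sqr_ge0 ?mulr_ge0 ?sqr_ge0//.
  have r21 : rho ^+ 2 <= 1 by rewrite expr_le1// ltW.
  by rewrite mulr_ile1 ?sqr_ge0.
have := le_integral_param qK.
have -> : v ^+ 2 * shrink_cst = K * (2 * pi) by rewrite /K /shrink_cst -/e; ring.
have : (0 <= \int[mu]_(x in param) (G1_density a0 a1 b1 a2 c h x)%:E)%E.
  by apply: integral_ge0 => x /qK/andP[]; rewrite lee_fin.
move=> I0 IK; rewrite -lee_fin /G1 /Rintegral fineK//.
by rewrite ge0_fin_numE// (le_lt_trans IK)// ltry.
Qed.

(** The path is linear in the square root of the dilation factor, which keeps its
speed bounded; when a1 > 0, the speed of a path linear in the factor itself is
unbounded near 0. *)
Lemma dist_ray (r0 r1 : R) : 0 < r0 -> r0 <= 1 -> 0 < r1 -> r1 <= 1 ->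
  (geodesic_dist a0 a1 b1 a2 (ray d (r0 ^+ 2)) (ray d (r1 ^+ 2)) <=
   (`|r1 - r0| * Num.sqrt shrink_cst)%:E)%E.
Proof.
move=> r00 r01 r10 r11.
pose v := r1 - r0.
pose rho t := r0 + v * t.
pose Q n t : R := match n with 0%N => rho t ^+ 2 | 1%N => 2 * rho t * v
   | 2%N => 2 * v ^+ 2 | _ => 0 end.
have drho t : is_derive t (1 : R) rho v.
  have := is_deriveD (is_derive_cst r0 t (1 : R)) (is_derive_scale v t).
  by rewrite add0r.
have dQ n t : is_derive t (1 : R) (Q n) (Q n.+1 t).
  case: n => [|[|[|n]]] /=.
  - have := is_deriveM (drho t) (drho t).
    have -> : rho t *: v + rho t *: v = 2 * rho t * v by rewrite /GRing.scale /=; ring.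
    by apply: near_eq_is_derive; near=> s; rewrite /Q expr2.
  - have := is_deriveZ (2 * v) (drho t).
    have -> : (2 * v) *: v = 2 * v ^+ 2 by rewrite /GRing.scale /=; ring.
    have -> : (2 * v) \*: rho = fun s => 2 * rho s * v.
      by apply/funext => s; rewrite -[LHS]/((2 * v) * rho s); ring.
    by [].
  - exact: is_derive_cst.
  - exact: is_derive_cst.
have rhot t : time t -> 0 < rho t /\ rho t <= 1.
  rewrite /Defs.time /= in_itv /= => /andP[t0 t1].
  have -> : rho t = (1 - t) * r0 + t * r1 by rewrite /rho /v; ring.
  by split; nra.
pose p t := ray d (Q 0 t).
have pip : immersion_path (ray d (r0 ^+ 2)) (ray d (r1 ^+ 2)) p.
  split.
  - exact: smooth_path_ray.
  - move=> t /rhot[rt _]; apply: immersion_ray => //.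
    by rewrite gt_eqF// exprn_gt0.
  - by move=> x _; rewrite /p /Q /rho mulr0 addr0.
  - by move=> x _; rewrite /p /Q /rho mulr1 /v addrC subrK.
apply: (@le_trans _ _ (path_length a0 a1 b1 a2 p)).
  by apply: ereal_inf_lbound; exists p.
have bound t : time t -> Num.sqrt (G1 a0 a1 b1 a2 (p t) (Dt p t) (Dt p t)) <=
    `|v| * Num.sqrt shrink_cst.
  move=> tt; have [rt0 rt1] := rhot t tt.
  have -> : Dt p t = ray d (2 * rho t * v) by exact: (iter_Dt_ray d dQ 1 tt).
  rewrite -sqrtr_sqr -sqrtrM ?sqr_ge0// ler_wsqrtr//.
  exact: G1_ray.
apply: (@le_trans _ _ (\int[mu]_(t in time) (`|v| * Num.sqrt shrink_cst)%:E)%E).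
  apply: ge0_ae_le_integral_subset.
  - by move=> t _; rewrite lee_fin sqrtr_ge0.
  - by move=> t _; rewrite lee_fin mulr_ge0 ?sqrtr_ge0.
  - by [].
  - by apply: nearW => t tt; rewrite lee_fin bound.
rewrite integral_cst//; last exact: measurable_itv.
rewrite [X in (_ * X)%E](_ : _ = 1%E) ?mule1//.
by rewrite /Defs.time [LHS]lebesgue_measure_itv /= lte_fin ltr01 -EFinB subr0.
Unshelve. all: by end_near. Qed.

(** A curve that takes the value c(pi) at every interior point has zero velocity
at pi. *)
Lemma immersion_separates (c : R -> 'rV[R]_d) : immersions c ->
  exists x y j, [/\ 0 < x, x < y, y < 2 * pi & c y ord0 j != c x ord0 j].
Proof.
move=> [Hc cI].
have pi0 : inner (pi : R) by rewrite /inner pi_gt0 mulr_natl mulr2n ltrDl pi_gt0.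
have [[y [j [yi cy]]]|H] :=
    pselect (exists y j, inner y /\ c y ord0 j != c pi ord0 j).
  have /andP[y0 y2] := yi; have /andP[p0 p2] := pi0.
  have [yp|py|yp] := ltgtP y pi.
  - by exists y, pi, j; rewrite eq_sym.
  - by exists pi, y, j.
  - by rewrite yp eqxx in cy.
have /negP[] := cI pi (inner_param pi0).
apply/eqP/rowP => j; rewrite Dtheta_coord mxE.
apply: (is_derive_deriv_on (nbhs_param pi0)).
apply: (@near_eq_is_derive _ _ _ (cst (c pi ord0 j))) => //.
move: (inner_nbhs pi0); apply: filterS => y yi /=; apply/eqP; rewrite eq_sym.
by apply: contra_notT H => cy; exists y, j.
Qed.

End Shrinking.

Theorem mainTheorem2 (R : realType) (d : nat) (a0 a1 b1 a2 : R) :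
  (2 <= d)%N -> 0 < a0 -> 0 <= a1 -> 0 <= b1 -> 0 < a2 ->
  ~ metrically_complete (@immersions R d) (geodesic_dist a0 a1 b1 a2).
Proof.
move=> d2 a00 a10 b10 a20 complete.
have d0 : (0 < d)%N by exact: ltnW.
pose rho n : R := step R 0 n.
have rho0 n : 0 < rho n by exact: step_gt0.
have rho1 n : rho n <= 1 by rewrite invf_le1// ler1n addn0.
pose u n := ray d (rho n ^+ 2).
have [] := complete u.
- by move=> n; apply: immersion_ray => //; rewrite gt_eqF// exprn_gt0.
- move=> e e0; pose K := Num.sqrt (shrink_cst d a0 a1 b1) + 1.
  have K0 : 0 < K by rewrite ltr_wpDl ?sqrtr_ge0.
  have eK : 0 < e / K by rewrite divr_gt0.
  have /cvgrPdist_lt/(_ _ eK)[N _ HN] := @cvg_step R 0.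
  exists N => m n Nm Nn.
  have hm : rho m < e / K by have := HN m Nm; rewrite /= sub0r normrN gtr0_norm.
  have hn : rho n < e / K by have := HN n Nn; rewrite /= sub0r normrN gtr0_norm.
  apply: le_lt_trans (dist_ray a00 a10 b10 a20 d0 (rho0 m) (rho1 m) (rho0 n) (rho1 n)) _.
  rewrite lte_fin; apply: (@le_lt_trans _ _ (`|rho n - rho m| * K)).
    by rewrite ler_wpM2l// lerDl.
  rewrite -ltr_pdivlMr// ltr_norml.
  by have := rho0 m; have := rho0 n; move=> ? ?; apply/andP; split; lra.
move=> c cI /fine_cvgP[fin cv].
have [x [y [j [x0 xy y2 cxy]]]] := immersion_separates cI.
pose D := c y ord0 j - c x ord0 j.
have D0 : D != 0 by rewrite subr_eq0.
pose delta := `|D|; have delta0 : 0 < delta by rewrite normr_gt0.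
pose kappa := delta / 2 / increment_cst a0 a2 (delta / 2).
have d20 : 0 < delta / 2 by rewrite divr_gt0.
have kappa0 : 0 < kappa by rewrite divr_gt0// increment_cst_gt0.
have dy : 0 < delta / 2 / (y - x) by rewrite divr_gt0// subr_gt0.
(* rho n ^ 2 <= rho n, so the initial chord is at most delta / 2. *)
have near1 : \forall n \near \oo, `|rho n| < delta / 2 / (y - x).
  have /cvgrPdist_lt/(_ _ dy) := @cvg_step R 0.
  by apply: filterS => n; rewrite sub0r normrN.
have near2 : \forall n \near \oo,
    `|fine (geodesic_dist a0 a1 b1 a2 (u n) c)| < kappa.
  have /cvgrPdist_lt/(_ _ kappa0) := cv.
  by apply: filterS => n; rewrite sub0r normrN.
suff : \forall n \near \oo, False by move=> /filter_ex[].
apply: filterS3 fin near1 near2 => n finn; rewrite gtr0_norm// => rhon dn.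
have : ((fine (geodesic_dist a0 a1 b1 a2 (u n) c))%:E < kappa%:E)%E.
  by rewrite lte_fin (le_lt_trans (ler_norm _)).
rewrite fineK// => /lt_le_trans dist_lt.
suff /dist_lt : (kappa%:E <= geodesic_dist a0 a1 b1 a2 (u n) c)%E by rewrite ltxx.
apply: le_ereal_inf_tmp => _ [p [sp ip p0 p1] <-].
have param' z : x <= z <= y -> param z by move=> /(inner_itv x0 y2)/inner_param.
have xp : param x by apply: param'; rewrite lexx ltW.
have yp : param y by apply: param'; rewrite lexx ltW.
apply: (@path_length_ge R d a0 a1 b1 a2 a00 a10 b10 a20 p x y j delta (Num.sg D)) => //.
- by rewrite normr_sg D0.
- rewrite !p0// !mxE -mulrBr; apply: le_trans (ler_norm _) _.
  rewrite normrM normr_sg D0 mul1r ger0_norm; last first.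
    by rewrite mulr_ge0 ?sqr_ge0// subr_ge0 ltW.
  rewrite -ler_pdivlMr ?subr_gt0//; apply: le_trans (ltW rhon).
  by rewrite expr2 ler_piMr// ltW.
- by rewrite !p1// /delta normrEsg.
Qed.
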